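(* Let $n,d\geq 1$, let $\mathfrak g=\mathfrak p(n)$, $V=\mathbb C^{n|n}$, and let $M$ be any $\mathfrak p(n)$-module. Then $$v\cdot s_a:=s_a(v),\qquad v\cdot \varepsilon_a:=\varepsilon_a(v),\qquad v\cdot y_j:=y_j(v)\qquad (v\in M\otimes V^{\otimes d},\ 1\le a\le d-1,\ 1\le j\le d),$$ where on the right-hand sides $s_a,\varepsilon_a,y_j$ are the operators on $M\otimes V^{\otimes d}$ defined in the context, defines a right action of the affine periplectic Brauer algebra $\widehat P_d^-$ on $M\otimes V^{\otimes d}$. In other words, there is an algebra homomorphism $$\Psi_M:\widehat P_d^-\longrightarrow \operatorname{End}_{\mathfrak g}(M\otimes V^{\otimes d})^{\mathrm{opp}}$$ sending each generator to the operator denoted by the same symbol.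
   Context: All spaces are over $\mathbb C$; $\overline{x}\in\mathbb Z_2$ denotes the parity of a homogeneous element $x$ of a superspace. Lie superalgebra and operators. Let $I=\{1,\dots,n,\bar1,\dots,\bar n\}$ with $\overline{\overline i}=i$. $V=\mathbb C^{n|n}$ has basis $\{e_i\}_{i\in I}$ with $e_1,\dots,e_n$ even and $e_{\bar 1},\dots,e_{\bar n}$ odd. $\mathfrak{gl}(n|n)$ is realized as $2n\times2n$ block matrices $\begin{pmatrix}A&B\\ C&D\end{pmatrix}$ acting on $V$, with supertrace $\mathrm{Str}=\mathrm{tr}A-\mathrm{tr}D$. The periplectic Lie superalgebra is $\mathfrak g=\mathfrak p(n)=\left\{\begin{pmatrix}A&U\\ L&-A^t\end{pmatrix}: U^t=U,\ L^t=-L\right\}\subset\mathfrak{gl}(n|n)$, and $\mathfrak g^*$ is identified with $\left\{\begin{pmatrix}A&J\\ K&A^t\end{pmatrix}: J^t=-J,\ K^t=K\right\}$, so $\mathfrak{gl}(n|n)=\mathfrak g\oplus\mathfrak g^*$. Let $\{x_i\}$ be a homogeneous basis of $\mathfrak g$ and $\{x_i^*\}\subset\mathfrak g^*$ the dual basis, $\mathrm{Str}(x_i^*x_j)=\delta_{ij}$. For a $\mathfrak g$-module $N$, let $C_{N,V}\in\operatorname{End}(N\otimes V)$ be the action of $C=\sum_i x_i\otimes x_i^*$: $C_{N,V}(m\otimes v)=\sum_i(-1)^{\overline{x_i^*}\,\overline m}x_im\otimes x_i^*v$. Let $s(e_a\otimes e_b)=(-1)^{\overline{e_a}\,\overline{e_b}}e_b\otimes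 e_a$ on $V^{\otimes2}$ and $\varepsilon=2C_{V,V}-s$. On $M\otimes V^{\otimes d}$ put $s_a=\mathrm{Id}^{\otimes a}\otimes s\otimes\mathrm{Id}^{\otimes(d-a-1)}$, $\varepsilon_a=\mathrm{Id}^{\otimes a}\otimes\varepsilon\otimes\mathrm{Id}^{\otimes(d-a-1)}$ (the first tensor factor being $M$), $y_j=2C_{M\otimes V^{\otimes(j-1)},V}\otimes\mathrm{Id}^{\otimes(d-j)}$. $\operatorname{End}_{\mathfrak g}$ denotes endomorphisms commuting with the $\mathfrak g$-action, and $\mathrm{opp}$ the opposite algebra (product $f\cdot g:=g\circ f$). The algebra $\widehat P_d^-$ is the associative unital $\mathbb C$-algebra generated by $s_a,\varepsilon_a$ ($1\le a\le d-1$), $y_j$ ($1\le j\le d$), subject to (for all indices for which the symbols make sense): (P.1) $s_a^2=1$; (P.2) $s_as_b=s_bs_a$ for $|a-b|>1$; $s_cs_{c+1}s_c=s_{c+1}s_cs_{c+1}$; $s_ay_i=y_is_a$ for $i\notin\{a,a+1\}$; (P.3) $\varepsilon_a^2=0$; (P.4) $\varepsilon_1y_1^k\varepsilon_1=0$ for all integers $k\ge1$; (P.5) $s_a\varepsilon_b=\varepsilon_bs_a$ and $\varepsilon_a\varepsilon_b=\varepsilon_b\varepsilon_a$ for $|a-b|>1$; $\varepsilon_ay_i=y_i\varepsilon_a$ for $i\notin\{a,a+1\}$; $y_iy_j=y_jy_i$; (P.6) $\varepsilon_as_a=-\varepsilon_a=-s_a\varepsilon_a$; $s_c\varepsilon_{c+1}\varepsilon_c=-s_{c+1}\varepsilon_c$,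 $\varepsilon_c\varepsilon_{c+1}s_c=\varepsilon_cs_{c+1}$; $\varepsilon_{c+1}\varepsilon_cs_{c+1}=-\varepsilon_{c+1}s_c$, $s_{c+1}\varepsilon_c\varepsilon_{c+1}=s_c\varepsilon_{c+1}$; $\varepsilon_{c+1}\varepsilon_c\varepsilon_{c+1}=-\varepsilon_{c+1}$, $\varepsilon_c\varepsilon_{c+1}\varepsilon_c=-\varepsilon_c$; (P.7) $s_ay_a-y_{a+1}s_a=\varepsilon_a-1$, $y_as_a-s_ay_{a+1}=-\varepsilon_a-1$; (P.8) $\varepsilon_a(y_a-y_{a+1})=\varepsilon_a$, $(y_a-y_{a+1})\varepsilon_a=-\varepsilon_a$. *)

(* Defs.v *)
From HB Require Import structures.
From mathcomp Require Import all_boot all_order all_algebra.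
From mathcomp Require Import boolp functions reals.
From mathcomp Require Import complex.
From mathcomp Require Import ring.

Set Implicit Arguments.
Unset Strict Implicit.
Unset Printing Implicit Defensive.

Import GRing.Theory.
Local Open Scope ring_scope.
Local Open Scope quotient_scope.

(* The associative unital K-algebra presented by generators G and relations
   rls: formal expressions in the generators modulo the smallest congruence
   that contains rls and the axioms of unital K-algebras.  It may be zero, hence
   is only a pzRingType (and an lmodType), not one of MathComp's nontrivial
   algebra structures. *)

Section Presentation.

Variables (K : comNzRingType) (G : Type).

Inductive expr :=
| Gen of G
| Cst of K
| Add of expr & expr
| Mul of expr & expr.

HB.instance Definition _ := gen_eqMixin expr.
HB.instance Definition _ := gen_choiceMixin expr.

Variable rls : expr -> expr -> Prop.

Inductive cong : expr -> expr -> Prop :=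
| cong_rel s t : rls s t -> cong s t
| cong_refl t : cong t t
| cong_sym s t : cong s t -> cong t s
| cong_trans s t u : cong s t -> cong t u -> cong s u
| cong_add s s' t t' : cong s s' -> cong t t' -> cong (Add s t) (Add s' t')
| cong_mul s s' t t' : cong s s' -> cong t t' -> cong (Mul s t) (Mul s' t')
| cong_addA s t u : cong (Add s (Add t u)) (Add (Add s t) u)
| cong_addC s t : cong (Add s t) (Add t s)
| cong_add0 t : cong (Add (Cst 0) t) t
| cong_mulA s t u : cong (Mul s (Mul t u)) (Mul (Mul s t) u)
| cong_mul0 t : cong (Mul (Cst 0) t) (Cst 0)
| cong_mul1 t : cong (Mul (Cst 1) t) t
| cong_mulDl s t u : cong (Mul (Add s t) u) (Add (Mul s u) (Mul t u))
| cong_mulDr s t u : cong (Mul s (Add t u)) (Add (Mul s t) (Mul s u))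
| cong_cstD a b : cong (Cst (a + b)) (Add (Cst a) (Cst b))
| cong_cstM a b : cong (Cst (a * b)) (Mul (Cst a) (Cst b))
| cong_cstC a t : cong (Mul (Cst a) t) (Mul t (Cst a)).

Definition congb : rel expr := fun s t => `[< cong s t >].

Lemma congb_refl : reflexive congb.
Proof. by move=> t; apply/asboolP; apply: cong_refl. Qed.

Lemma congb_sym : symmetric congb.
Proof. by move=> s t; apply/asboolP/asboolP; apply: cong_sym. Qed.

Lemma congb_trans : transitive congb.
Proof.
by move=> t s u /asboolP st /asboolP tu; apply/asboolP; apply: cong_trans st tu.
Qed.

Canonical congb_equiv := EquivRel congb congb_refl congb_sym congb_trans.

Definition palg := {eq_quot congb_equiv}.
HB.instance Definition _ := Choice.on palg.
HB.instance Definition _ := Quotient.on palg.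

Definition pcls (t : expr) : palg := \pi_palg t.
Definition pgen (g : G) : palg := pcls (Gen g).

Lemma pclsP s t : pcls s = pcls t <-> cong s t.
Proof.
by split=> [/eqmodP/asboolP //|st]; apply/eqmodP/asboolP.
Qed.

Lemma pclsK (x : palg) : pcls (repr x) = x.
Proof. exact: reprK. Qed.

Lemma cong_repr t : cong (repr (pcls t)) t.
Proof. by apply/pclsP; rewrite pclsK. Qed.

Definition padd (x y : palg) := pcls (Add (repr x) (repr y)).
Definition pmul (x y : palg) := pcls (Mul (repr x) (repr y)).
Definition pscale (a : K) (x : palg) := pmul (pcls (Cst a)) x.

Lemma pcls_add s t : padd (pcls s) (pcls t) = pcls (Add s t).
Proof. by apply/pclsP; apply: cong_add; apply: cong_repr. Qed.

Lemma pcls_mul s t : pmul (pcls s) (pcls t) = pcls (Mul s t).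
Proof. by apply/pclsP; apply: cong_mul; apply: cong_repr. Qed.

Lemma palg_ind (P : palg -> Prop) : (forall t, P (pcls t)) -> forall x, P x.
Proof. by move=> h x; rewrite -(pclsK x). Qed.

Fact paddA : associative padd.
Proof.
elim/palg_ind=> s; elim/palg_ind=> t; elim/palg_ind=> u.
by rewrite !pcls_add; apply/pclsP/cong_addA.
Qed.
Fact paddC : commutative padd.
Proof.
elim/palg_ind=> s; elim/palg_ind=> t.
by rewrite !pcls_add; apply/pclsP/cong_addC.
Qed.
Fact padd0 : left_id (pcls (Cst 0)) padd.
Proof. by elim/palg_ind=> s; rewrite !pcls_add; apply/pclsP/cong_add0. Qed.
Fact pscaleDl x a b : pscale (a + b) x = padd (pscale a x) (pscale b x).
Proof.
elim/palg_ind: x => s; rewrite /pscale !pcls_mul pcls_add; apply/pclsP.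
apply: cong_trans (cong_mulDl _ _ _); apply: cong_mul (cong_refl _).
exact: cong_cstD.
Qed.
Fact pscale1 : left_id 1 pscale.
Proof.
by elim/palg_ind=> s; rewrite /pscale !pcls_mul; apply/pclsP/cong_mul1.
Qed.
Fact paddN : left_inverse (pcls (Cst 0)) (pscale (- 1)) padd.
Proof.
move=> x; rewrite -[X in padd _ X]pscale1 -pscaleDl addNr.
by elim/palg_ind: x => s; rewrite /pscale !pcls_mul; apply/pclsP/cong_mul0.
Qed.

HB.instance Definition _ := GRing.isZmodule.Build palg paddA paddC padd0 paddN.

Fact pmulA : associative pmul.
Proof.
elim/palg_ind=> s; elim/palg_ind=> t; elim/palg_ind=> u.
by rewrite !pcls_mul; apply/pclsP/cong_mulA.
Qed.
Fact pmulC a x : pmul (pcls (Cst a)) x = pmul x (pcls (Cst a)).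
Proof.
by elim/palg_ind: x => s; rewrite !pcls_mul; apply/pclsP/cong_cstC.
Qed.
Fact pmul1 : left_id (pcls (Cst 1)) pmul.
Proof. exact: pscale1. Qed.
Fact pmulr1 : right_id (pcls (Cst 1)) pmul.
Proof. by move=> x; rewrite -pmulC pmul1. Qed.
Fact pmulDl : left_distributive pmul +%R.
Proof.
elim/palg_ind=> s; elim/palg_ind=> t; elim/palg_ind=> u.
rewrite /GRing.add /= !(pcls_mul, pcls_add).
exact/pclsP/cong_mulDl.
Qed.
Fact pmulDr : right_distributive pmul +%R.
Proof.
elim/palg_ind=> s; elim/palg_ind=> t; elim/palg_ind=> u.
rewrite /GRing.add /= !(pcls_mul, pcls_add).
exact/pclsP/cong_mulDr.
Qed.

HB.instance Definition _ :=
  GRing.Zmodule_isPzRing.Build palg pmulA pmul1 pmulr1 pmulDl pmulDr.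

Fact pscaleA a b x : pscale a (pscale b x) = pscale (a * b) x.
Proof.
rewrite /pscale pmulA pcls_mul; congr pmul; apply/pclsP.
exact/cong_sym/cong_cstM.
Qed.
Fact pscaleDr : right_distributive pscale +%R.
Proof. by move=> a x y; apply: pmulDr. Qed.
Fact pscaleDl' x : {morph pscale^~ x : a b / a + b}.
Proof. exact: pscaleDl. Qed.

HB.instance Definition _ :=
  GRing.Zmodule_isLmodule.Build K palg pscaleA pscale1 pscaleDr pscaleDl'.

Lemma palg_scaleAl (a : K) (x y : palg) : a *: (x * y) = (a *: x) * y.
Proof. exact: pmulA. Qed.

Lemma palg_scaleAr (a : K) (x y : palg) : a *: (x * y) = x * (a *: y).
Proof.
rewrite /GRing.scale /= /pscale pmulC -[LHS]/(x * y * pcls (Cst a)) -mulrA.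
by congr (x * _); rewrite -[LHS]/(pmul _ _) pmulC.
Qed.

End Presentation.

Arguments Cst {K G}.
Arguments Gen {K G}.

Declare Scope expr_scope.
Delimit Scope expr_scope with expr.
Bind Scope expr_scope with expr.
Notation "0" := (Cst 0%R) : expr_scope.
Notation "1" := (Cst 1%R) : expr_scope.
Notation "x + y" := (Add x y) : expr_scope.
Notation "x * y" := (Mul x y) : expr_scope.
Notation "- x" := (Mul (Cst (-1)%R) x) : expr_scope.
Notation "x - y" := (x + - y)%expr : expr_scope.
Notation "x ^+ k" := (iter k (Mul x) (Cst 1%R)) : expr_scope.

(* Indices are counted from 0: the a-th generators GS a and GE a, a < d - 1, and
   GY j, j < d, are the s_{a+1}, epsilon_{a+1} and y_{j+1} of the usual
   1-based numbering. *)

Inductive apb_gen (d : nat) :=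
| GS of 'I_d.-1
| GE of 'I_d.-1
| GY of 'I_d.

Section AffinePeriplecticBrauer.

Variables (K : comNzRingType) (d : nat).

Let s (a : 'I_d.-1) : expr K (apb_gen d) := Gen (GS a).
Let e (a : 'I_d.-1) : expr K (apb_gen d) := Gen (GE a).
Let y (j : 'I_d) : expr K (apb_gen d) := Gen (GY j).

Definition far (a b : nat) := (a.+1 < b)%N || (b.+1 < a)%N.

Local Open Scope expr_scope.

(* In the relations below c' stands for c + 1, and j, j' for a, a + 1 seen as
   indices of the y's. *)
Inductive apb_rel : expr K (apb_gen d) -> expr K (apb_gen d) -> Prop :=
| apb_P1 a : apb_rel (s a * s a) 1
| apb_P2_far (a b : 'I_d.-1) : far a b -> apb_rel (s a * s b) (s b * s a)
| apb_P2_braid (c c' : 'I_d.-1) : c' = c.+1 :> nat ->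
    apb_rel (s c * s c' * s c) (s c' * s c * s c')
| apb_P2_y (a : 'I_d.-1) (i : 'I_d) : i != a :> nat -> i != a.+1 :> nat ->
    apb_rel (s a * y i) (y i * s a)
| apb_P3 a : apb_rel (e a * e a) 0
| apb_P4 (a : 'I_d.-1) (j : 'I_d) (k : nat) : a = 0%N :> nat -> j = 0%N :> nat ->
    (1 <= k)%N -> apb_rel (e a * y j ^+ k * e a) 0
| apb_P5_se (a b : 'I_d.-1) : far a b -> apb_rel (s a * e b) (e b * s a)
| apb_P5_ee (a b : 'I_d.-1) : far a b -> apb_rel (e a * e b) (e b * e a)
| apb_P5_ey (a : 'I_d.-1) (i : 'I_d) : i != a :> nat -> i != a.+1 :> nat ->
    apb_rel (e a * y i) (y i * e a)
| apb_P5_yy i j : apb_rel (y i * y j) (y j * y i)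
| apb_P6_es a : apb_rel (e a * s a) (- e a)
| apb_P6_se a : apb_rel (- e a) (- (s a * e a))
| apb_P6_see (c c' : 'I_d.-1) : c' = c.+1 :> nat ->
    apb_rel (s c * e c' * e c) (- (s c' * e c))
| apb_P6_ees (c c' : 'I_d.-1) : c' = c.+1 :> nat ->
    apb_rel (e c * e c' * s c) (e c * s c')
| apb_P6_ees' (c c' : 'I_d.-1) : c' = c.+1 :> nat ->
    apb_rel (e c' * e c * s c') (- (e c' * s c))
| apb_P6_see' (c c' : 'I_d.-1) : c' = c.+1 :> nat ->
    apb_rel (s c' * e c * e c') (s c * e c')
| apb_P6_eee (c c' : 'I_d.-1) : c' = c.+1 :> nat ->
    apb_rel (e c' * e c * e c') (- e c')
| apb_P6_eee' (c c' : 'I_d.-1) : c' = c.+1 :> nat ->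
    apb_rel (e c * e c' * e c) (- e c)
| apb_P7_sy (a : 'I_d.-1) (j j' : 'I_d) : j = a :> nat -> j' = a.+1 :> nat ->
    apb_rel (s a * y j - y j' * s a) (e a - 1)
| apb_P7_ys (a : 'I_d.-1) (j j' : 'I_d) : j = a :> nat -> j' = a.+1 :> nat ->
    apb_rel (y j * s a - s a * y j') (- e a - 1)
| apb_P8_l (a : 'I_d.-1) (j j' : 'I_d) : j = a :> nat -> j' = a.+1 :> nat ->
    apb_rel (e a * (y j - y j')) (e a)
| apb_P8_r (a : 'I_d.-1) (j j' : 'I_d) : j = a :> nat -> j' = a.+1 :> nat ->
    apb_rel ((y j - y j') * e a) (- e a).

Definition apb : Type := palg apb_rel.
HB.instance Definition _ := GRing.PzRing.on apb.
HB.instance Definition _ := GRing.Lmodule.on apb.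

Definition apb_s (a : 'I_d.-1) : apb := pgen _ (GS a).
Definition apb_e (a : 'I_d.-1) : apb := pgen _ (GE a).
Definition apb_y (j : 'I_d) : apb := pgen _ (GY j).

End AffinePeriplecticBrauer.

Section BlockLinear.

Variables (R : pzRingType) (m1 m2 n1 n2 : nat).

HB.instance Definition _ :=
  GRing.Linear.copy (@ulsubmx R m1 m2 n1 n2) (lsubmx \o usubmx).
HB.instance Definition _ :=
  GRing.Linear.copy (@ursubmx R m1 m2 n1 n2) (rsubmx \o usubmx).
HB.instance Definition _ :=
  GRing.Linear.copy (@dlsubmx R m1 m2 n1 n2) (lsubmx \o dsubmx).
HB.instance Definition _ :=
  GRing.Linear.copy (@drsubmx R m1 m2 n1 n2) (rsubmx \o dsubmx).

End BlockLinear.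

Section Periplectic.

Variables (K : fieldType) (n : nat).

(* The basis of V = K^{n|n} is indexed by 'I_(n + n): the index lshift n i is i,
   and rshift n i is its barred version. *)
Definition ipar (i : 'I_(n + n)) : bool := (n <= i)%N.

Definition glpr (b : bool) (x : 'M[K]_(n + n)) : 'M[K]_(n + n) :=
  \matrix_(i, j) (if ipar i (+) ipar j == b then x i j else 0).

Definition glhom (b : bool) (x : 'M[K]_(n + n)) : bool := glpr b x == x.

(* The parity of a nonzero homogeneous matrix. *)
Definition glpar (x : 'M[K]_(n + n)) : bool := ~~ glhom false x.

Definition str (x : 'M[K]_(n + n)) : K := \tr (ulsubmx x) - \tr (drsubmx x).

Definition glbr (x y : 'M[K]_(n + n)) : 'M[K]_(n + n) :=
  \sum_(p : bool) \sum_(q : bool)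
    (glpr p x *m glpr q y - (-1) ^+ (p && q) *: (glpr q y *m glpr p x)).

Definition pnV : {vspace 'M[K]_(n + n)} :=
  (lker (linfun (drsubmx \+ (trmx \o ulsubmx)))
   :&: lker (linfun ((trmx \o ursubmx) \- ursubmx))
   :&: lker (linfun ((trmx \o dlsubmx) \+ dlsubmx)))%VS.

Definition pnVd : {vspace 'M[K]_(n + n)} :=
  (lker (linfun (drsubmx \- (trmx \o ulsubmx)))
   :&: lker (linfun ((trmx \o ursubmx) \+ ursubmx))
   :&: lker (linfun ((trmx \o dlsubmx) \- dlsubmx)))%VS.

Lemma mem_pnV x : (x \in pnV) = [&& drsubmx x == - (ulsubmx x)^T,
  (ursubmx x)^T == ursubmx x & (dlsubmx x)^T == - dlsubmx x].
Proof.
by rewrite !memv_cap !memv_ker !lfunE /= addr_eq0 subr_eq0 addr_eq0 -andbA.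
Qed.

Lemma mem_pnVd x : (x \in pnVd) = [&& drsubmx x == (ulsubmx x)^T,
  (ursubmx x)^T == - ursubmx x & (dlsubmx x)^T == dlsubmx x].
Proof.
by rewrite !memv_cap !memv_ker !lfunE /= subr_eq0 addr_eq0 subr_eq0 -andbA.
Qed.

Lemma pnVP x : reflect
  (exists A U L, [/\ U^T = U, L^T = - L & x = block_mx A U L (- A^T)])
  (x \in pnV).
Proof.
rewrite mem_pnV; apply: (iffP and3P) => [[/eqP dr /eqP ur /eqP dl]|].
  exists (ulsubmx x), (ursubmx x), (dlsubmx x); split=> //.
  by rewrite -dr submxK.
case=> A [U [L [hU hL ->]]].
by rewrite block_mxKul block_mxKur block_mxKdl block_mxKdr hU hL !eqxx.
Qed.

Lemma pnVdP x : reflect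
  (exists A J L, [/\ J^T = - J, L^T = L & x = block_mx A J L A^T])
  (x \in pnVd).
Proof.
rewrite mem_pnVd; apply: (iffP and3P) => [[/eqP dr /eqP ur /eqP dl]|].
  exists (ulsubmx x), (ursubmx x), (dlsubmx x); split=> //.
  by rewrite -dr submxK.
case=> A [U [L [hU hL ->]]].
by rewrite block_mxKul block_mxKur block_mxKdl block_mxKdr hU hL !eqxx.
Qed.

Lemma ipar_lshift i : ipar (lshift n i) = false.
Proof. by rewrite /ipar /= leqNgt ltn_ord. Qed.

Lemma ipar_rshift i : ipar (rshift n i) = true.
Proof. by rewrite /ipar /= leq_addr. Qed.

Lemma glpr0_block A B C D : glpr false (block_mx A B C D) = block_mx A 0 0 D.
Proof.
apply/matrixP=> i j; rewrite !mxE.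
case: (split_ordP i) => i' ->; rewrite ?ipar_lshift ?ipar_rshift !mxE;
by case: (split_ordP j) => j' ->; rewrite ?ipar_lshift ?ipar_rshift //= !mxE.
Qed.

Lemma glpr1_block A B C D : glpr true (block_mx A B C D) = block_mx 0 B C 0.
Proof.
apply/matrixP=> i j; rewrite !mxE.
case: (split_ordP i) => i' ->; rewrite ?ipar_lshift ?ipar_rshift !mxE;
by case: (split_ordP j) => j' ->; rewrite ?ipar_lshift ?ipar_rshift //= !mxE.
Qed.

Lemma glprK p q x : glpr p (glpr q x) = if p == q then glpr q x else 0.
Proof.
apply/matrixP=> i j; rewrite mxE; case: (p =P q) => [->|/eqP pq]; rewrite !mxE.
  by case: eqP.
by case: eqP => // ->; rewrite (negPf pq).
Qed.

Lemma glbr_hom p q x y : glhom p x -> glhom q y ->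
  glbr x y = x *m y - (-1) ^+ (p && q) *: (y *m x).
Proof.
move=> /eqP hx /eqP hy; rewrite /glbr (bigD1 p) //= (bigD1 q) //= hx hy.
rewrite [X in _ + X + _]big1 ?[X in _ + X]big1 ?addr0 //.
- move=> p' pp; apply: big1 => q' _.
  by rewrite -hx glprK (negPf pp) mul0mx mulmx0 scaler0 subr0.
- move=> q' qq.
  by rewrite -hy glprK (negPf qq) mul0mx mulmx0 scaler0 subr0.
Qed.

Lemma glbr_pn x y : x \in pnV -> y \in pnV -> glbr x y \in pnV.
Proof.
have trD (X Y : 'M[K]_n) : (X + Y)^T = X^T + Y^T by rewrite linearD.
have trN (X : 'M[K]_n) : (- X)^T = - X^T by rewrite linearN.
case/pnVP=> A [U [L [hU hL ->]]] /pnVP[B [W [N [hW hN ->]]]].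
rewrite /glbr !big_bool /= !glpr0_block !glpr1_block !mulmx_block.
rewrite !(mul0mx, mulmx0, addr0, add0r) expr0 expr1 !scale1r !scaleN1r.
rewrite !opp_block_mx !add_block_mx !(oppr0, addr0, add0r, opprK) mem_pnV.
rewrite !(block_mxKul, block_mxKur, block_mxKdl, block_mxKdr).
rewrite !(trD, trN, trmx_mul, trmxK, hU, hL, hW, hN).
rewrite !(mulmxN, mulNmx, opprK).
by apply/and3P; split; apply/eqP/matrixP=> i j; rewrite !mxE; ring.
Qed.

End Periplectic.

Notation "''p[' K ]_ n" := (subvs_of (pnV K n))
  (at level 0, n at level 2, format "''p[' K ]_ n") : type_scope.

Definition pbr (K : fieldType) (n : nat) (x y : 'p[K]_n) : 'p[K]_n :=
  Subvs (glbr_pn (valP x) (valP y)).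

(* A p(n)-module: a vector space M = M_0 (+) M_1, given by the projections
   ppr b onto M_b, with an even linear action of p(n). *)
Record pmod (K : fieldType) (n : nat) := PMod {
  pmod_car :> lmodType K;
  ppr : bool -> {linear pmod_car -> pmod_car};
  pact : 'p[K]_n -> {linear pmod_car -> pmod_car};
  pprK : forall b c m, ppr b (ppr c m) = if b == c then ppr c m else 0;
  pprD : forall m, ppr false m + ppr true m = m;
  pact_linear : forall m, linear (pact^~ m);
  pact_par : forall p q x m, glhom p (vsval x) -> ppr q m = m ->
    ppr (p (+) q) (pact x m) = pact x m;
  pact_br : forall p q x y m, glhom p (vsval x) -> glhom q (vsval y) ->
    pact (pbr x y) m
    = pact x (pact y m) - (-1) ^+ (p && q) *: pact y (pact x m)
}.

Section PModTheory.

Variables (K : fieldType) (n : nat) (N : pmod K n).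

Lemma glhomE p (x : 'M[K]_(n + n)) i j : glhom p x ->
  x i j = if ipar i (+) ipar j == p then x i j else 0.
Proof. by move=> /eqP hx; rewrite -{1}hx mxE. Qed.

Definition psgn (b : bool) (m : N) : N :=
  ppr N false m + (-1) ^+ b *: ppr N true m.

Fact psgn_linear b : linear (psgn b).
Proof.
move=> c u v; rewrite /psgn !linearP /= !scalerDr !scalerA.
by rewrite addrACA.
Qed.
HB.instance Definition _ b :=
  GRing.isLinear.Build K N N *:%R (psgn b) (psgn_linear b).

Lemma psgnM b c m : psgn b (psgn c m) = psgn (b (+) c) m.
Proof.
rewrite /psgn.
rewrite !(raddfD (ppr N _)) /= !(linearZ_LR (ppr N _)) /= !pprK /=.
by rewrite !scaler0 addr0 add0r scalerA signr_addb.
Qed.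

Lemma psgn0 m : psgn false m = m.
Proof. by rewrite /psgn scale1r pprD. Qed.

Lemma psgnE b m : psgn b m = \sum_(q : bool) (-1) ^+ (b && q) *: ppr N q m.
Proof. by rewrite big_bool /= andbT andbF scale1r addrC. Qed.

Lemma ppr_psgn b c m : ppr N b (psgn c m) = psgn c (ppr N b m).
Proof.
rewrite /psgn (raddfD (ppr N _)) /= (linearZ_LR (ppr N _)) /= !pprK.
by case: b; rewrite ?linear0 ?scaler0.
Qed.

Lemma ppr_act p q (x : 'p[K]_n) m : glhom p (vsval x) ->
  ppr N q (pact N x m) = pact N x (ppr N (p (+) q) m).
Proof.
move=> hx.
have hp b : ppr N (p (+) b) (pact N x (ppr N b m)) = pact N x (ppr N b m).
  by apply: pact_par => //; rewrite pprK eqxx.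
have hq b : ppr N q (pact N x (ppr N b m))
    = if q == p (+) b then pact N x (ppr N b m) else 0.
  by rewrite -hp pprK.
rewrite -{1}(pprD m) (raddfD (pact N x)) (raddfD (ppr N q)) /= !hq.
by case: p q {hx hp hq} => -[] /=; rewrite ?addr0 ?add0r.
Qed.

Lemma psgn_act p b (x : 'p[K]_n) m : glhom p (vsval x) ->
  psgn b (pact N x m) = (-1) ^+ (p && b) *: pact N x (psgn b m).
Proof.
move=> hx; rewrite /psgn !(ppr_act _ _ hx) (raddfD (pact N x)) /=.
rewrite (linearZ_LR (pact N x)) /=.
case: p {hx}; case: b => /=; rewrite ?scale1r ?scaleN1r ?opprD ?opprK //.
  by rewrite addrC.
by rewrite addrC.
Qed.

End PModTheory.

Section Tensor.

Variables (K : fieldType) (n : nat).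

Local Notation I := 'I_(n + n).
Local Notation e j := (delta_mx j 0 : 'cV[K]_(n + n)).

Section NatMod.

Definition nat_ppr (b : bool) (v : 'cV[K]_(n + n)) : 'cV[K]_(n + n) :=
  \col_i (if ipar i == b then v i 0 else 0).

Definition nat_act (x : 'p[K]_n) (v : 'cV[K]_(n + n)) : 'cV[K]_(n + n) :=
  vsval x *m v.

Fact nat_ppr_linear b : linear (nat_ppr b).
Proof.
move=> c u v; apply/colP=> i; rewrite !mxE; case: eqP => // _.
by rewrite mulr0 addr0.
Qed.
HB.instance Definition _ b := GRing.isLinear.Build K _ _ *:%R
  (nat_ppr b) (nat_ppr_linear b).

Fact nat_act_linear x : linear (nat_act x).
Proof. by move=> c u v; rewrite /nat_act mulmxDr scalemxAr. Qed.
HB.instance Definition _ x := GRing.isLinear.Build K _ _ *:%R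
  (nat_act x) (nat_act_linear x).

Fact nat_pprK b c v :
  nat_ppr b (nat_ppr c v) = if b == c then nat_ppr c v else 0.
Proof.
apply/colP=> i; case: (b =P c) => [->|bc]; rewrite !mxE; first by case: eqP.
by case: eqP => // ib; case: eqP => // ic; case: bc; rewrite -ib -ic.
Qed.

Fact nat_pprD v : nat_ppr false v + nat_ppr true v = v.
Proof.
by apply/colP=> i; rewrite !mxE; case: ipar; rewrite ?add0r ?addr0.
Qed.

Fact nat_pact_linear v : linear (nat_act^~ v).
Proof. by move=> c x y; rewrite /nat_act linearP /= mulmxDl -scalemxAl. Qed.

Fact nat_pact_par p q (x : 'p[K]_n) v : glhom p (vsval x) ->
  nat_ppr q v = v -> nat_ppr (p (+) q) (nat_act x v) = nat_act x v.
Proof.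
move=> hx hv; apply/colP=> i; rewrite mxE; case: eqP => // ipq.
rewrite mxE big1 // => j _; rewrite (glhomE _ _ hx) -hv mxE.
case: eqP => [ijp|_]; last by rewrite ?mul0r ?mulr0.
case: eqP => [jq|_]; last by rewrite ?mul0r ?mulr0.
by case: ipq; rewrite -ijp -jq -addbA addbb addbF.
Qed.

Fact nat_pact_br p q (x y : 'p[K]_n) v :
  glhom p (vsval x) -> glhom q (vsval y) ->
  nat_act (pbr x y) v
  = nat_act x (nat_act y v) - (-1) ^+ (p && q) *: nat_act y (nat_act x v).
Proof.
move=> hx hy; rewrite /nat_act /= (glbr_hom hx hy) mulmxBl -scalemxAl.
by rewrite !mulmxA.
Qed.

Definition natV : pmod K n := @PMod K n 'cV[K]_(n + n) nat_ppr nat_act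
  nat_pprK nat_pprD nat_pact_linear nat_pact_par nat_pact_br.

End NatMod.

Section TensV.

Variable N : pmod K n.

(* N (x) V is realized as the space of functions from the basis of V to N, the
   function w standing for sum_j (w j) (x) e_j. *)
Definition tens (m : N) (v : 'cV[K]_(n + n)) : {ffun I -> N} :=
  [ffun i => v i 0 *: m].

Definition tens_ppr (b : bool) (w : {ffun I -> N}) : {ffun I -> N} :=
  \sum_j tens (ppr N (b (+) ipar j) (w j)) (e j).

(* x (m (x) v) = x m (x) v + (-1)^(|x| |m|) m (x) x v *)
Definition tens_act (x : 'p[K]_n) (w : {ffun I -> N}) : {ffun I -> N} :=
  \sum_j (tens (pact N x (w j)) (e j)
    + \sum_(p : bool) \sum_(q : bool)
        (-1) ^+ (p && q) *: tens (ppr N q (w j)) (glpr p (vsval x) *m e j)).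

Lemma sum_tens (F : I -> N) i : (\sum_j tens (F j) (e j)) i = F i.
Proof.
rewrite sum_ffunE (bigD1 i) //= big1 => [|j ji]; rewrite ffunE mxE ?eqxx /=.
  by rewrite scale1r addr0.
by rewrite eq_sym (negPf ji) scale0r.
Qed.

Lemma tens_pprE b w i : tens_ppr b w i = ppr N (b (+) ipar i) (w i).
Proof. exact: sum_tens. Qed.

Lemma mul_delta (x : 'M[K]_(n + n)) i j : (x *m e j) i 0 = x i j.
Proof. by rewrite -colE mxE. Qed.

Lemma tens_actE x w i : tens_act x w i = pact N x (w i)
  + \sum_j vsval x i j *: psgn (ipar i (+) ipar j) (w j).
Proof.
rewrite /tens_act big_split /= ffunE sum_tens; congr (_ + _).
rewrite sum_ffunE; apply: eq_bigr => j _.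
rewrite psgnE scaler_sumr sum_ffunE (bigD1 (ipar i (+) ipar j)) //=.
rewrite [X in _ + X]big1 ?addr0 => [|p pij]; last first.
  rewrite sum_ffunE big1 // => q _; rewrite !ffunE mul_delta mxE.
  by rewrite eq_sym (negPf pij) scale0r scaler0.
rewrite sum_ffunE; apply: eq_bigr => q _.
by rewrite !ffunE mul_delta mxE eqxx !scalerA mulrC.
Qed.

Fact tens_ppr_linear b : linear (tens_ppr b).
Proof.
by move=> c u v; apply/ffunP=> i; rewrite !(tens_pprE, ffunE) linearP.
Qed.
HB.instance Definition _ b := GRing.isLinear.Build K _ _ *:%R
  (tens_ppr b) (tens_ppr_linear b).

Fact tens_act_linear x : linear (tens_act x).
Proof.
move=> c u v; apply/ffunP=> i; rewrite !(tens_actE, ffunE) linearP /=.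
rewrite scalerDr addrACA; congr (_ + _).
rewrite scaler_sumr -big_split; apply: eq_bigr => j _ /=.
by rewrite !ffunE linearP /= scalerDr !scalerA mulrC.
Qed.
HB.instance Definition _ x := GRing.isLinear.Build K _ _ *:%R
  (tens_act x) (tens_act_linear x).

Fact tens_pprK b c w :
  tens_ppr b (tens_ppr c w) = if b == c then tens_ppr c w else 0.
Proof.
apply/ffunP=> i; rewrite !tens_pprE pprK.
have -> : (b (+) ipar i == c (+) ipar i) = (b == c) by case: b c ipar => -[] [].
by case: eqP => _; rewrite ?tens_pprE ?ffunE.
Qed.

Fact tens_pprD w : tens_ppr false w + tens_ppr true w = w.
Proof.
apply/ffunP=> i; rewrite ffunE !tens_pprE -[RHS]pprD.
by case: ipar => //=; rewrite addrC.
Qed.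

Fact tens_pact_linear w : linear (tens_act^~ w).
Proof.
move=> c x y; apply/ffunP=> i; rewrite !(tens_actE, ffunE) pact_linear /=.
rewrite scalerDr addrACA; congr (_ + _).
rewrite scaler_sumr -big_split; apply: eq_bigr => j _ /=.
by rewrite !mxE scalerDl scalerA.
Qed.

Definition sumact (x : 'M[K]_(n + n)) (w : {ffun I -> N}) i : N :=
  \sum_j x i j *: w j.

Lemma tens_act_hom p x w i : glhom p (vsval x) ->
  tens_act x w i = pact N x (w i) + psgn p (sumact (vsval x) w i).
Proof.
move=> hx; rewrite tens_actE; congr (_ + _).
rewrite /sumact raddf_sum /=; apply: eq_bigr => j _.
rewrite linearZ_LR /= (glhomE _ _ hx); case: eqP => [<-//|_].
by rewrite !scale0r.
Qed.

Fact tens_pact_par p q (x : 'p[K]_n) w : glhom p (vsval x) ->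
  tens_ppr q w = w -> tens_ppr (p (+) q) (tens_act x w) = tens_act x w.
Proof.
move=> hx hw.
have hwi i : ppr N (q (+) ipar i) (w i) = w i by rewrite -tens_pprE hw.
apply/ffunP=> i; rewrite tens_pprE !tens_actE raddfD /=; congr (_ + _).
  by rewrite -addbA pact_par.
rewrite raddf_sum /=; apply: eq_bigr => j _.
rewrite linearZ_LR /= (glhomE _ _ hx); case: eqP => [ijp|_]; last first.
  by rewrite !scale0r.
congr (_ *: _); rewrite ppr_psgn -ijp.
have -> : ipar i (+) ipar j (+) q (+) ipar i = q (+) ipar j.
  by case: (ipar i); case: (ipar j); case: q {hw hwi}.
by rewrite hwi.
Qed.

Lemma sumact_psgn b x i (w w' : {ffun I -> N}) :
  (forall j, w' j = psgn b (w j)) -> sumact x w' i = psgn b (sumact x w i).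
Proof.
move=> hw; rewrite /sumact raddf_sum /=; apply: eq_bigr => j _.
by rewrite hw linearZ_LR.
Qed.

Lemma pact_sumact x y w i :
  pact N x (sumact y w i) = sumact y [ffun j => pact N x (w j)] i.
Proof.
rewrite /sumact raddf_sum /=; apply: eq_bigr => j _.
by rewrite ffunE linearZ_LR.
Qed.

Lemma sumactM x y w i : sumact (x *m y) w i
  = sumact x [ffun j => sumact y w j] i.
Proof.
rewrite /sumact; under eq_bigr do rewrite mxE scaler_suml.
rewrite exchange_big; apply: eq_bigr => j _ /=.
rewrite ffunE scaler_sumr; apply: eq_bigr => k _.
by rewrite scalerA.
Qed.

Lemma tens_act2 p q (x y : 'p[K]_n) w i :
  glhom p (vsval x) -> glhom q (vsval y) ->
  tens_act x (tens_act y w) i = pact N x (pact N y (w i))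
  + (-1) ^+ (p && q) *: psgn q (sumact (vsval y) [ffun j => pact N x (w j)] i)
  + (psgn p (sumact (vsval x) [ffun j => pact N y (w j)] i)
     + psgn (p (+) q) (sumact (vsval x *m vsval y) w i)).
Proof.
move=> hx hy; rewrite (tens_act_hom _ _ hx) (tens_act_hom _ _ hy).
rewrite raddfD /=; congr (_ + _); first congr (_ + _).
  rewrite -pact_sumact (psgn_act _ _ hx) scalerA -signr_addb addbb.
  by rewrite scale1r.
rewrite -psgnM; rewrite -(raddfD (psgn p)) /=; congr psgn.
rewrite sumactM -(@sumact_psgn q _ _ _ [ffun j => psgn q (sumact (vsval y) w j)]).
  rewrite /sumact -big_split; apply: eq_bigr => j _ /=.
  by rewrite -scalerDr (tens_act_hom _ _ hy) !ffunE.
by move=> j; rewrite !ffunE.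
Qed.

Fact tens_pact_br p q (x y : 'p[K]_n) w :
  glhom p (vsval x) -> glhom q (vsval y) ->
  tens_act (pbr x y) w
  = tens_act x (tens_act y w) - (-1) ^+ (p && q) *: tens_act y (tens_act x w).
Proof.
move=> hx hy; apply/ffunP=> i; rewrite !ffunE.
have hxy : glhom (p (+) q) (vsval (pbr x y)).
  rewrite /= (glbr_hom hx hy); apply/eqP/matrixP=> k l; rewrite mxE.
  case: eqP => // klpq; rewrite !mxE !big1 ?mulr0 ?subrr // => j _.
    rewrite (glhomE _ _ hx) (glhomE _ _ hy).
    case: eqP => [xe|]; last by rewrite ?mul0r ?mulr0.
    case: eqP => [ye|]; last by rewrite ?mul0r ?mulr0.
    by case: klpq; rewrite -xe -ye; case: (ipar k); case: (ipar j); case: ipar.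
  rewrite (glhomE _ _ hx) (glhomE _ _ hy).
  case: eqP => [xe|]; last by rewrite ?mul0r ?mulr0.
  case: eqP => [ye|]; last by rewrite ?mul0r ?mulr0.
  by case: klpq; rewrite -xe -ye; case: (ipar k); case: (ipar j); case: ipar.
rewrite (tens_act_hom _ _ hxy) (pact_br _ hx hy) /= (glbr_hom hx hy).
rewrite (tens_act2 _ _ hx hy) (tens_act2 _ _ hy hx).
set A := pact N x _; set B := pact N y _.
have -> : sumact (vsval x *m vsval y - (-1) ^+ (p && q) *: (vsval y *m vsval x))
    w i = sumact (vsval x *m vsval y) w i
      - (-1) ^+ (p && q) *: sumact (vsval y *m vsval x) w i.
  rewrite /sumact scaler_sumr -sumrB; apply: eq_bigr => j _.
  by rewrite !mxE scalerBl scalerA.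
rewrite raddfB /= (linearZ_LR (psgn _)) /= (addbC q p) (andbC q p).
have ss : (-1) ^+ (p && q) * (-1) ^+ (p && q) = 1 :> K.
  by rewrite -signr_addb addbb.
rewrite (scalerDr _ (B + _)) (scalerDr _ B) (scalerDr _ (psgn q _)).
rewrite [_ *: (_ *: psgn p _)]scalerA ss scale1r.
have zE (a b u v s t : N) :
    a - b + (s - t) = a + u + (v + s) - (b + v + (u + t)).
  rewrite (addrC v) (addrC u t) [a + u + _]addrACA (addrACA b) (addrC v) opprD.
  by rewrite (addrACA (a + s)) subrr addr0 opprD addrACA.
exact: zE.
Qed.

Definition tensV : pmod K n := @PMod K n {ffun I -> N} tens_ppr tens_act
  tens_pprK tens_pprD tens_pact_linear tens_pact_par tens_pact_br.

End TensV.

(* pnVd is identified with the dual of p(n) by the pairing (y, x) |-> str (y x). *)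
Record dual_bases := DualBases {
  db_size : nat;
  db_x : db_size.-tuple 'p[K]_n;
  db_xs : 'I_db_size -> 'M[K]_(n + n);
  db_basis : basis_of fullv db_x;
  db_hom : forall k, exists b, glhom b (vsval (tnth db_x k));
  db_xs_in : forall k, db_xs k \in pnVd K n;
  db_dual : forall i j, str (db_xs i *m vsval (tnth db_x j)) = (i == j)%:R
}.

Variable B : dual_bases.
Local Notation x k := (tnth (db_x B) k).
Local Notation xs k := (db_xs (d := B) k).

(* C_{N,V} (m (x) v) = sum_k (-1)^(|x_k^*| |m|) x_k m (x) x_k^* v *)
Definition opC (N : pmod K n) (w : tensV N) : tensV N :=
  \sum_(k < db_size B) \sum_(j < n + n) \sum_(p : bool)
    (-1) ^+ (glpar (xs k) && p)
      *: tens (pact N (x k) (ppr N p (w j))) (xs k *m e j).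

Local Notation VV := (tensV natV).

(* w = sum_(a, b) (w b) a 0 (e_a (x) e_b) *)
Definition swapVV (w : VV) : VV :=
  \sum_(a < n + n) \sum_(b < n + n)
    ((-1) ^+ (ipar a && ipar b) * (w b : 'cV[K]_(n + n)) a 0)
      *: tens (e b : natV) (e a).

Definition epsVV (w : VV) : VV := 2 *: opC w - swapVV w.

(* m (x) u, for m in N and u in V (x) V, as an element of (N (x) V) (x) V *)
Definition tens2 (N : pmod K n) (m : N) (u : VV) : tensV (tensV N) :=
  \sum_(a < n + n) \sum_(b < n + n)
    (u b : 'cV[K]_(n + n)) a 0 *: tens (tens m (e a) : tensV N) (e b).

(* Id_N (x) f; there is no sign since it is only used for even f. *)
Definition id_tens (f : VV -> VV) (N : pmod K n) (w : tensV (tensV N)) :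
    tensV (tensV N) :=
  \sum_(a < n + n) \sum_(b < n + n)
    tens2 ((w b : tensV N) a) (f (tens (e a : natV) (e b))).

(* f (x) Id_V *)
Definition tens_id (N : pmod K n) (f : N -> N) (w : tensV N) : tensV N :=
  \sum_(j < n + n) tens (f (w j)) (e j).

Variable M : pmod K n.

(* M (x) V^{(x) d} = (...((M (x) V) (x) V)...) (x) V *)
Definition tensVn (d : nat) : pmod K n := iter d tensV M.

(* f acting on the last two copies of V; the value for d = 1 is never used *)
Definition last2 (f : VV -> VV) (d : nat) : tensVn d.+1 -> tensVn d.+1 :=
  match d return tensVn d.+1 -> tensVn d.+1 with
  | 0 => id
  | d'.+1 => id_tens f (N := tensVn d')
  end.

(* f acting on the copies a and a + 1 of V (numbered from 0), for a + 1 < d *)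
Fixpoint op2 (f : VV -> VV) (d a : nat) {struct d} : tensVn d -> tensVn d :=
  match d return tensVn d -> tensVn d with
  | 0 => id
  | d'.+1 => if a.+1 == d' then last2 f (d := d')
             else tens_id (op2 f (d := d') a)
  end.

Definition op_s (d a : nat) : tensVn d -> tensVn d := op2 swapVV a.
Definition op_e (d a : nat) : tensVn d -> tensVn d := op2 epsVV a.

(* 2 C_{M (x) V^{(x) j}, V} (x) Id, for j < d *)
Fixpoint op_y (d j : nat) {struct d} : tensVn d -> tensVn d :=
  match d return tensVn d -> tensVn d with
  | 0 => id
  | d'.+1 => if j == d' then fun w => 2 *: opC (N := tensVn d') w
             else tens_id (op_y (d := d') j)
  end.

End Tensor.

Section Endg.

Variables (K : fieldType) (n : nat) (N : pmod K n).

Definition endg_pred : {pred N -> N} := fun f =>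
  `[< linear f /\ forall (x : 'p[K]_n) m, f (pact N x m) = pact N x (f m) >].

Fact endg_submod_closed : submod_closed endg_pred.
Proof.
split.
  apply/asboolP; split=> [c u v|x m]; first by rewrite scaler0 addr0.
  by rewrite linear0.
move=> c f g /asboolP[fl fx] /asboolP[gl gx]; apply/asboolP; split.
  move=> a u v; rewrite !fctE fl gl !scalerDr !scalerA addrACA.
  by rewrite (mulrC c).
by move=> x m; rewrite !fctE fx gx linearP.
Qed.
HB.instance Definition _ :=
  GRing.isSubmodClosed.Build K (N -> N) endg_pred endg_submod_closed.

Record endg := Endg {
  endg_fun :> N -> N;
  endg_prop : endg_fun \in endg_pred
}.

HB.instance Definition _ := [isSub for endg_fun].
HB.instance Definition _ := [Choice of endg by <:].
HB.instance Definition _ := [SubChoice_isSubLmodule of endg by <:].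

Fact endg_id_subproof : (id : N -> N) \in endg_pred.
Proof. exact/asboolP. Qed.

Fact endg_comp_subproof (f g : endg) : (f \o g : N -> N) \in endg_pred.
Proof.
have /asboolP[fl fx] := endg_prop f; have /asboolP[gl gx] := endg_prop g.
apply/asboolP.
by split=> [c u v|x m] /=; rewrite ?gl ?fl ?gx ?fx.
Qed.

Definition endg_id : endg := Endg endg_id_subproof.
Definition endg_comp (f g : endg) : endg := Endg (endg_comp_subproof f g).

Fact endg_compA : associative endg_comp.
Proof. by move=> f g h; apply: val_inj. Qed.
Fact endg_comp1 : left_id endg_id endg_comp.
Proof. by move=> f; apply: val_inj. Qed.
Fact endg_compr1 : right_id endg_id endg_comp.
Proof. by move=> f; apply: val_inj. Qed.
Fact endg_compDl : left_distributive endg_comp +%R.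
Proof. by move=> f g h; apply: val_inj. Qed.
Fact endg_compDr : right_distributive endg_comp +%R.
Proof.
move=> f g h; apply: val_inj; apply/funext=> v /=.
have /asboolP[fl _] := endg_prop f.
by have := fl 1 (g v) (h v); rewrite !scale1r.
Qed.

HB.instance Definition _ := GRing.Zmodule_isPzRing.Build endg
  endg_compA endg_comp1 endg_compr1 endg_compDl endg_compDr.

(* The opposite ring endg^c with the scalar multiplication of endg. *)
HB.instance Definition _ := GRing.Lmodule.copy endg^c endg.

Lemma endg_oppM (f g : endg^c) v : (f * g : endg^c) v = g (f v).
Proof. by []. Qed.

Lemma endg_oppZ (c : K) (f : endg^c) v : (c *: f : endg^c) v = c *: f v.
Proof. by []. Qed.

End Endg.

(* Main.v *)
Require Import Defs.
From HB Require Import structures.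
From mathcomp Require Import all_boot all_order all_algebra.
From mathcomp Require Import boolp.
From mathcomp Require Import reals complex.
From mathcomp Require Import ring.

Set Implicit Arguments.
Unset Strict Implicit.
Unset Printing Implicit Defensive.

Import GRing.Theory.
Local Open Scope ring_scope.

(** The idea is to make the Casimir element explicit and to check the relations
    in coordinates.

    The subalgebra p(n) of gl(n|n) is the fixed space of an involutive
    automorphism [theta], and its dual is the other eigenspace.  Hence, whatever
    the dual bases, 2 C is the matrix on the factor V whose (i, j) entry is the
    element (-1)^i (E_ji + theta E_ji) of p(n) ([casel_dual], [opC_casimir]).
    On V (x) V its two terms are the flip s and an operator of rank one, which
    therefore is epsilon: it contracts with the odd form that pairs e_i with
    e_(bar i), then creates the dual tensor ([id_tens_eps]).

    Since [theta] is an automorphism, the entries of C transform under the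
    bracket as matrix units do ([glbr_casmx]), and so C_{N,V} commutes with p(n)
    ([casimir_even_hom]); it is also natural in N ([casimir_natural]), which
    gives all the commutation relations that involve the y_j.  Splitting the
    action of p(n) on N (x) V into its two parts yields
      y_(a+1) = s_a y_a s_a + s_a + epsilon_a                 ([casimir_tensE]).
    As y and s are equivariant, so is epsilon ([cupcap_even_hom]).  The same
    identity expresses how s exchanges y_a and y_(a+1), and the symmetry of the
    entries of C under i |-> bar i ([casimir_cup], [cap_casimir_flip]) turns it
    into the relations between epsilon_a and y_a - y_(a+1).  The relations
    between s and epsilon alone are identities between permutations, cups and
    caps of at most three copies of V.

    The vanishing of epsilon_1 y_1^k epsilon_1 is a formal consequence of the
    other relations: moving s across y^k in epsilon y^k epsilon changes the sign
    of this word, up to words with fewer letters y ([sandwich_eq0]).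

    An operator that fixes the last factor V acts on each coefficient with
    respect to the basis of this factor.  Hence a relation holds for all d as
    soon as it holds where its operators reach the last factor ([tower_eq]).
    The homomorphism is then given by the universal property of the presented
    algebra ([palg_lift]), multiplication in the opposite algebra being
    composition in the order of the right action. *)

(** * The involution that defines p(n) and the entries of the Casimir element *)

Section Casimir.

Variables (K : fieldType) (n : nat).

Local Notation I := 'I_(n + n).
Local Notation glM := 'M[K]_(n + n).

Definition bar (i : I) : I :=
  match split i with inl k => rshift n k | inr k => lshift n k end.

Lemma bar_lshift k : bar (lshift n k) = rshift n k.
Proof.
by rewrite /bar; case: split_ordP => j /eqP; rewrite eq_shift // => /eqP->.
Qed.

Lemma bar_rshift k : bar (rshift n k) = lshift n k.
Proof.
by rewrite /bar; case: split_ordP => j /eqP; rewrite eq_shift // => /eqP->.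
Qed.

Lemma barK : involutive bar.
Proof.
by move=> i; case: (split_ordP i) => j ->;
  rewrite ?bar_lshift ?bar_rshift ?bar_lshift.
Qed.

Lemma ipar_bar i : ipar (bar i) = ~~ ipar i.
Proof.
by case: (split_ordP i) => j ->;
  rewrite ?bar_lshift ?bar_rshift ?ipar_lshift ?ipar_rshift.
Qed.

Lemma eq_bar i j : (bar i == j) = (i == bar j).
Proof. by rewrite -[j in LHS]barK (inj_eq (inv_inj barK)). Qed.

(** Minus a supertransposition, hence an automorphism of gl(n|n). The entrywise
    form [thetaE] shows that E_ji is sent to E_(bar i)(bar j) up to sign. *)
Definition theta (x : glM) : glM :=
  block_mx (- (drsubmx x)^T) (ursubmx x)^T (- (dlsubmx x)^T) (- (ulsubmx x)^T).

Lemma thetaE x k l :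
  theta x k l = - (-1) ^+ (~~ ipar k && ipar l) * x (bar l) (bar k).
Proof.
rewrite /theta.
case: (split_ordP k) => i ->; case: (split_ordP l) => j ->;
  rewrite ?block_mxEul ?block_mxEur ?block_mxEdl ?block_mxEdr !mxE
    ?ipar_lshift ?ipar_rshift ?bar_lshift ?bar_rshift /=; ring.
Qed.

Lemma thetaK : involutive theta.
Proof.
move=> x; rewrite /theta block_mxKul block_mxKur block_mxKdl block_mxKdr.
by rewrite !(linearN, trmxK) /= !trmxK !opprK submxK.
Qed.

Lemma mem_pnV_theta x : (x \in pnV K n) = (theta x == x).
Proof.
apply/pnVP/eqP => [[A [U [L [hU hL ->]]]]|hx].
  rewrite /theta block_mxKul block_mxKur block_mxKdl block_mxKdr.
  by rewrite hU hL linearN /= trmxK !opprK.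
exists (ulsubmx x), (ursubmx x), (dlsubmx x).
have hul : ulsubmx x = - (drsubmx x)^T by rewrite -[in LHS]hx block_mxKul.
have hur : ursubmx x = (ursubmx x)^T by rewrite -[in LHS]hx block_mxKur.
have hdl : dlsubmx x = - (dlsubmx x)^T by rewrite -[in LHS]hx block_mxKdl.
split; first by rewrite -hur.
  by rewrite [in RHS]hdl opprK.
by rewrite hul linearN /= trmxK opprK -hul submxK.
Qed.

Fact theta_linear : linear theta.
Proof. by move=> c x y; apply/matrixP=> i j; rewrite !(thetaE, mxE); ring. Qed.
HB.instance Definition _ := GRing.isLinear.Build K glM glM *:%R
  theta theta_linear.

(** This is the automorphism property [theta [x, y] = [theta x, theta y]] at a
    fixed point x of [theta]. *)
Lemma theta_glbr x y : x \in pnV K n -> theta (glbr x y) = glbr x (theta y).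
Proof.
have trD (X Y : 'M[K]_n) : (X + Y)^T = X^T + Y^T by rewrite linearD.
have trN (X : 'M[K]_n) : (- X)^T = - X^T by rewrite linearN.
case/pnVP=> A [U [L [hU hL ->]]].
rewrite -[y in LHS]submxK.
rewrite /glbr !big_bool /= /theta !glpr0_block !glpr1_block !mulmx_block.
rewrite !(mul0mx, mulmx0, addr0, add0r) expr0 expr1 !scale1r !scaleN1r.
rewrite !opp_block_mx !add_block_mx !(oppr0, addr0, add0r, opprK).
rewrite !(block_mxKul, block_mxKur, block_mxKdl, block_mxKdr).
rewrite !(trD, trN, trmx_mul, trmxK, hU, hL).
rewrite !(mulmxN, mulNmx, opprK).
by congr block_mx; apply/matrixP=> i j; rewrite !mxE; ring.
Qed.

Lemma theta_glpr b x : theta (glpr b x) = glpr b (theta x).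
Proof.
apply/matrixP=> i j; rewrite !(thetaE, mxE) !ipar_bar.
by case: (ipar i); case: (ipar j); case: b => //=; rewrite ?mulr0.
Qed.

Lemma strD (u v : glM) : str (u + v) = str u + str v.
Proof. by rewrite /str !linearD /=; ring. Qed.

Lemma strZ c (u : glM) : str (c *: u) = c * str u.
Proof. by rewrite /str !linearZ /=; ring. Qed.

(** The pairing str (y x) changes sign under [theta], and so does every y in
    the dual of p(n), the -1 eigenspace: the two signs cancel. *)
Lemma str_thetaE x y : y \in pnVd K n -> str (y *m theta x) = str (y *m x).
Proof.
have trN (X : 'M[K]_n) : \tr (- X) = - \tr X by rewrite linearN.
case/pnVdP=> A [J [L [hJ hL ->]]]; rewrite -[x in RHS]submxK /theta.
set a := ulsubmx x; set b := ursubmx x; set c := dlsubmx x; set d := drsubmx x.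
rewrite !mulmx_block /str !(block_mxKul, block_mxKdr) !mxtraceD.
rewrite !mulmxN !trN.
rewrite -(mxtrace_tr (A *m d^T)) -(mxtrace_tr (J *m c^T)) -(mxtrace_tr (L *m
  b^T)).
rewrite -(mxtrace_tr (A^T *m a^T)) !trmx_mul !trmxK hJ hL mulmxN trN.
rewrite (mxtrace_mulC d) (mxtrace_mulC c) (mxtrace_mulC b) (mxtrace_mulC a).
by ring.
Qed.

Lemma str_mul_delta (y : glM) i j :
  str (y *m delta_mx j i) = (-1) ^+ ipar i * y i j.
Proof.
have E k : (y *m delta_mx j i) k k = (k == i)%:R * y i j.
  rewrite mxE (bigD1 j) //= big1 => [|l lj]; rewrite mxE.
    by rewrite eqxx /= addr0 mulrC; case: eqP => [->|]; rewrite ?mul0r.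
  by rewrite (negPf lj) mulr0.
rewrite /str /mxtrace.
under eq_bigr do rewrite mxE mxE E.
under [X in _ - X]eq_bigr do rewrite mxE mxE E.
case: (split_ordP i) => k ->; rewrite ?ipar_lshift ?ipar_rshift.
  rewrite (bigD1 k) //= eqxx !big1 => [|l _|l lk];
    rewrite ?eq_shift ?(negPf lk) ?mul0r //.
  by rewrite addr0 subr0.
rewrite [X in X - _]big1 => [|l _]; last by rewrite eq_shift mul0r.
rewrite (bigD1 k) //= eqxx big1 => [|l lk];
  rewrite ?eq_shift ?(negPf lk) ?mul0r //.
by rewrite addr0 sub0r mul1r expr1 mulN1r.
Qed.

(** Twice the projection to p(n) of (-1)^i E_ji, the matrix unit that
    represents the linear form y |-> y i j for the supertrace pairing; see
    [str_casmx]. *)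
Definition casmx (i j : I) : glM :=
  (-1) ^+ ipar i *: (delta_mx j i + theta (delta_mx j i)).

Lemma casmx_in i j : casmx i j \in pnV K n.
Proof. by rewrite mem_pnV_theta /casmx linearZ /= linearD /= thetaK addrC. Qed.

Definition casel (i j : I) : 'p[K]_n := Subvs (casmx_in i j).

Lemma casmxE i j k l : casmx i j k l =
  (-1) ^+ ipar i * (((k == j) && (l == i))%:R
    - (-1) ^+ (ipar i && ~~ ipar j) * ((k == bar i) && (l == bar j))%:R).
Proof.
rewrite /casmx mxE [X in _ * X]mxE thetaE !mxE !eq_bar; congr (_ * (_ + _)).
rewrite (andbC (l == bar j)) mulNr; congr (- _).
by case: (k =P _) => [->|]; case: (l =P _) => [->|] /=;
  rewrite ?mulr0 ?ipar_bar ?negbK.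
Qed.

Lemma casmx_hom i j : glhom (ipar i (+) ipar j) (casmx i j).
Proof.
apply/eqP/matrixP=> k l; rewrite mxE; case: eqP => // kl.
rewrite casmxE; case: (@andP (k == j)) => [[/eqP ki /eqP lj]|_].
  by case: kl; rewrite ki lj addbC.
case: (@andP (k == bar i)) => [[/eqP ki /eqP lj]|_];
  last by rewrite /= mulr0 subr0 mulr0.
by case: kl; rewrite ki lj !ipar_bar; case: (ipar i); case: ipar.
Qed.

Lemma casel_hom i j : glhom (ipar i (+) ipar j) (vsval (casel i j)).
Proof. exact: casmx_hom. Qed.

(** [theta] exchanges the matrix units of which casmx b (bar a) and casmx a
    (bar b) are made. *)
Lemma casmx_bar a b :
  casmx b (bar a) = - ((-1) ^+ (ipar a (+) ipar b (+) (ipar a && ipar b))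
    *: casmx a (bar b)).
Proof.
apply/matrixP=> k l.
have oppZ_mxE c (x : glM) : (- (c *: x)) k l = - (c * x k l) by rewrite !mxE.
rewrite oppZ_mxE !casmxE !ipar_bar !barK !negbK.
set p := (k == bar a) && _; set q := (k == bar b) && _.
by case: (ipar a); case: (ipar b) => /=; ring.
Qed.

Lemma str_casmx y i j : y \in pnVd K n -> str (y *m casmx i j) = 2 * y i j.
Proof.
move=> hy.
rewrite /casmx -scalemxAr strZ mulmxDr strD str_thetaE // str_mul_delta.
by rewrite -mulrDr mulrA; case: ipar; ring.
Qed.

End Casimir.

(** * The bracket of p(n) with the entries of the Casimir element *)

Section Bracket.

Variables (K : fieldType) (n : nat).

Local Notation I := 'I_(n + n).
Local Notation glM := 'M[K]_(n + n).

Lemma mulmx_deltar (x : glM) (i j : I) :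
  x *m delta_mx j i = \sum_l x l j *: (delta_mx l i : glM).
Proof.
apply/matrixP=> a b; rewrite mxE summxE (bigD1 j) //= [X in _ + X]big1 => [|c
  cj].
  rewrite (bigD1 a) //= [X in _ = _ + X]big1 => [|c ca].
    by rewrite !mxE !eqxx.
  by rewrite !mxE eq_sym (negPf ca) mulr0.
by rewrite mxE (negPf cj) mulr0.
Qed.

Lemma mulmx_deltal (x : glM) (i j : I) : (delta_mx j i :
  glM) *m x = \sum_l x i l *: (delta_mx j l : glM).
Proof.
apply/matrixP=> a b; rewrite mxE summxE (bigD1 i) //= [X in _ + X]big1 => [|c
  ci].
  rewrite (bigD1 b) //= [X in _ = _ + X]big1 => [|c cb].
    by rewrite !mxE !eqxx !addr0 !andbT mulrC.
  by rewrite !mxE [b == c]eq_sym (negPf cb) andbF mulr0.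
by rewrite mxE (negPf ci) andbF mul0r.
Qed.

Lemma delta_hom (i j : I) : glhom (ipar i (+) ipar j) (delta_mx j i : glM).
Proof.
apply/eqP/matrixP=> k l; rewrite !mxE; case: eqP => // kl.
by case: eqP => // kj; case: eqP => // li; case: kl; rewrite kj li addbC.
Qed.

(** The entries of the Casimir element are the images of matrix units under 1 +
    [theta], which commutes with the bracket by x: the formula is the one for
    the bracket of x with a matrix unit. *)
Lemma glbr_casmx p (x : glM) i j : x \in pnV K n -> glhom p x ->
  glbr x (casmx K i j) = \sum_l x l j *: casmx K i l
    - \sum_l ((-1) ^+ (p && (ipar l (+) ipar j)) * x i l) *: casmx K l j.
Proof.
move=> xg hx.
have hE := delta_hom i j.
have hT : glhom (ipar i (+) ipar j) (theta (delta_mx j i : glM)).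
  by rewrite /glhom -theta_glpr (eqP hE).
have -> : glbr x (casmx K i j)
    = (-1) ^+ ipar i *: (glbr x (delta_mx j i) + theta (glbr x (delta_mx j i))).
  rewrite theta_glbr // (glbr_hom hx (casmx_hom K i j)) (glbr_hom hx hE).
  rewrite (glbr_hom hx hT) /casmx -scalemxAl -scalemxAr mulmxDr mulmxDl.
  rewrite [_ *: (_ *: _)]scalerA [_ * (-1) ^+ ipar i]mulrC -scalerA -scalerBr.
  by rewrite (scalerDr (_ ^+ (p && _))) opprD addrACA.
rewrite (glbr_hom hx hE) mulmx_deltar mulmx_deltal.
rewrite linearB (linearZ_LR (@theta K n)) /= !(linear_sum (@theta K n)) /=
  addrACA -opprD -scalerDr -!big_split /=.
rewrite scalerBr !scaler_sumr; congr (_ - _).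
  apply: eq_bigr => l _;
    rewrite (linearZ_LR (@theta K n)) /= -scalerDr !scalerA mulrC.
  by rewrite -scalerA.
apply: eq_bigr => l _;
  rewrite (linearZ_LR (@theta K n)) /= -scalerDr /casmx !scalerA.
rewrite {1 2}(glhomE i l hx); case: eqP => [<-|_];
  last by rewrite !(mulr0, mul0r).
congr (_ *: _); case: (ipar i); case: (ipar j); case: (ipar l) => /=; ring.
Qed.

Lemma pbr_casel p (x : 'p[K]_n) i j : glhom p (vsval x) ->
  pbr x (casel K i j) = \sum_l vsval x l j *: casel K i l
    - \sum_l ((-1) ^+ (p && (ipar l (+) ipar j)) * vsval x i l) *: casel K l j.
Proof.
move=> hx; apply: val_inj => /=; rewrite (glbr_casmx i j (valP x) hx).
by rewrite !(linear_sum vsval).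
Qed.

Lemma glpr_pn b x : x \in pnV K n -> glpr b x \in pnV K n.
Proof. by rewrite !mem_pnV_theta theta_glpr => /eqP->. Qed.

Definition ppart b (x : 'p[K]_n) : 'p[K]_n := Subvs (glpr_pn b (valP x)).

Lemma ppart_hom b x : glhom b (vsval (ppart b x)).
Proof. by rewrite /glhom /= glprK eqxx. Qed.

Lemma ppartD x : ppart false x + ppart true x = x.
Proof.
apply: val_inj => /=; apply/matrixP=> i j.
by rewrite !mxE; case: (_ (+) _); rewrite ?addr0 ?add0r.
Qed.

End Bracket.

(** * Independence of the dual bases *)

Section DualBases.

Variables (K : fieldType) (n : nat) (B : dual_bases K n).
Hypothesis two_neq0 : 2 != 0 :> K.

Local Notation x k := (tnth (db_x B) k).
Local Notation xs k := (db_xs (d := B) k).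

Lemma str_sum I (r : seq I) (F : I -> 'M[K]_(n + n)) :
  str (\sum_(i <- r) F i) = \sum_(i <- r) str (F i).
Proof.
elim: r => [|i r IH]; last by rewrite !big_cons strD IH.
by rewrite !big_nil /str !linear0 subr0.
Qed.

(** The coefficient of x_k is the supertrace pairing with x_k^*, which
    [str_casmx] evaluates. *)
Lemma casel_dual i j : casel K i j = \sum_k (2 * xs k i j) *: x k.
Proof.
rewrite [LHS](coord_basis (db_basis B) (memvf _)); apply: eq_bigr => k _.
rewrite -(tnth_nth 0); congr (_ *: _).
rewrite -(str_casmx i j (db_xs_in k)).
have -> : casmx K i j = \sum_l coord (db_x B) l (casel K i j) *: vsval (x l).
  rewrite -[casmx K i j]/(vsval (casel K i j)).
  rewrite [in LHS](coord_basis (db_basis B) (memvf (casel K i j))) linear_sum.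
  by apply: eq_bigr => l _; rewrite (tnth_nth 0) linearZ.
rewrite mulmx_sumr str_sum (bigD1 k) //= big1 => [|l lk].
  by rewrite -scalemxAr strZ db_dual eqxx mulr1 addr0.
by rewrite -scalemxAr strZ db_dual eq_sym (negPf lk) mulr0.
Qed.

(** The elements casel i j are homogeneous, so in [casel_dual] only the x_k of
    parity |i| + |j| have nonzero coefficients. *)
Lemma dual_parity k i j : xs k i j != 0 -> glpar (xs k) = ipar i (+) ipar j.
Proof.
have [b hb] := db_hom k.
have E i' j' : xs k i' j' != 0 -> b = ipar i' (+) ipar j'.
  set q := _ (+) _; apply: contraNeq => bq.
  have : str (xs k *m glpr q (casmx K i' j')) = 2 * xs k i' j'.
    by rewrite (eqP (casmx_hom K i' j')) str_casmx // db_xs_in.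
  have -> : glpr q (casmx K i' j')
    = \sum_l (2 * xs l i' j') *: glpr q (vsval (x l)).
    rewrite -[casmx K i' j']/(vsval (casel K i' j')) casel_dual linear_sum /=.
    apply/matrixP=> a c; rewrite mxE !summxE; case: eqP => [ac|ac].
      by apply: eq_bigr => l _; rewrite !mxE ac eqxx.
    by rewrite big1 // => l _; rewrite !mxE; case: eqP => // _; rewrite mulr0.
  rewrite mulmx_sumr str_sum big1 => [/esym/eqP|l _].
    by rewrite mulf_eq0 (negPf two_neq0).
  rewrite -scalemxAr strZ; have [c hc] := db_hom l.
  rewrite -(eqP hc) glprK; case: eqP => [qc|_]; last first.
    by rewrite mulmx0 /str !linear0 subr0 mulr0.
  rewrite (eqP hc) db_dual; case: eqP => [kl|_]; last by rewrite mulr0.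
  move: hc hb; rewrite -kl -qc => hq hb'.
  have x0 : vsval (x k) = 0.
    by rewrite -(eqP hb') -(eqP hq) glprK (negPf bq).
  have := db_dual (d := B) k k; rewrite x0 mulmx0 /str !linear0 subr0 eqxx.
  by move/esym/eqP; rewrite oner_eq0.
move=> nz; rewrite -(E _ _ nz) /glpar; case: b hb E => hb E.
  apply/eqP=> h; move: nz; rewrite -h mxE; case: ifP => [/eqP e|];
    last by rewrite eqxx.
  by move=> nz; have := E _ _ nz; rewrite e.
apply/negbTE; rewrite negbK; apply/eqP/matrixP=> a c; rewrite mxE.
by case: eqP => // ac; apply/esym/eqP; apply: contraT => /E /esym.
Qed.

(** The operator 2 C_{N,V}, in a form where no dual basis appears: psgn is the
    Koszul sign of moving an element of parity |i| + |j| across N. *)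
Definition casimir (N : pmod K n) (w : tensV N) : tensV N :=
  [ffun i =>
    \sum_(j < n + n) pact N (casel K i j) (psgn (ipar i (+) ipar j) (w j))].

Lemma opC_casimir (N : pmod K n) (w : tensV N) : 2 *: opC B w = casimir w.
Proof.
apply/ffunP=> i; rewrite !ffunE sum_ffunE scaler_sumr.
under eq_bigr do rewrite sum_ffunE scaler_sumr.
rewrite exchange_big; apply: eq_bigr => j _ /=.
pose F y := pact N y (psgn (ipar i (+) ipar j) (w j)).
have linF : linear F by apply: pact_linear.
pose FL : {linear _ -> _} := HB.pack F (GRing.isLinear.Build K _ _ *:%R F linF).
rewrite -[RHS]/(FL (casel K i j)) casel_dual linear_sum; apply: eq_bigr => k _.
rewrite linearZ /= /F sum_ffunE.
have [e0|nz] := eqVneq (xs k i j) 0.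
  rewrite e0 mulr0 scale0r big1 ?scaler0 // => p _.
  by rewrite !ffunE mul_delta e0 scale0r scaler0.
rewrite -(dual_parity nz) psgnE (linear_sum (pact N (x k))) !scaler_sumr;
  apply: eq_bigr => p _ /=.
rewrite !ffunE mul_delta (linearZ_LR (pact N (x k))) /= !scalerA;
  congr (_ *: _).
by rewrite -!mulrA [X in 2 * X]mulrC.
Qed.

End DualBases.

(** * Even equivariant maps, and the equivariance of the Casimir operator *)

Section EvenMaps.

Variables (K : fieldType) (n : nat).
Implicit Types N : pmod K n.

Local Notation I := 'I_(n + n).

(** Evenness is part of the definition because f (x) id commutes with the
    action on N (x) V, whose formula contains Koszul signs, only for even f. *)
Definition even_hom N (f : N -> N) := [/\ linear f,
  forall b m, f (ppr N b m) = ppr N b (f m)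
  & forall x m, f (pact N x m) = pact N x (f m)].

Lemma even_hom_linear N (f : N -> N) :
  even_hom f -> exists g : {linear N -> N}, f =1 g.
Proof.
case=> lf _ _.
pose g : {linear N -> N} := HB.pack f (GRing.isLinear.Build K N N *:%R f lf).
by exists g.
Qed.

Lemma even_hom_sum N (f : N -> N) : even_hom f ->
  forall F : I -> N, f (\sum_i F i) = \sum_i f (F i).
Proof.
case/even_hom_linear=> g fg F; rewrite fg linear_sum; apply: eq_bigr => i _.
by rewrite fg.
Qed.

Lemma even_homZ N (f : N -> N) :
  even_hom f -> forall c m, f (c *: m) = c *: f m.
Proof. by case/even_hom_linear=> g fg c m; rewrite !fg linearZ. Qed.

Lemma even_homD N (f : N -> N) :
  even_hom f -> forall m m', f (m + m') = f m + f m'.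
Proof. by case/even_hom_linear=> g fg c m; rewrite !fg linearD. Qed.

Lemma even_hom_psgn N (f : N -> N) : even_hom f ->
  forall b m, f (psgn b m) = psgn b (f m).
Proof.
by move=> hf b m; have [_ fp _] := hf;
  rewrite /psgn even_homD // even_homZ // !fp.
Qed.

Lemma psgn_sum N b (F : I -> N) : psgn b (\sum_i F i) = \sum_i psgn b (F i).
Proof. exact: raddf_sum. Qed.

Lemma pact_sumr N x (F : I -> N) :
  pact N x (\sum_i F i) = \sum_i pact N x (F i).
Proof. exact: raddf_sum. Qed.

Lemma psgnZ N b c (m : N) : psgn b (c *: m) = c *: psgn b m.
Proof. exact: linearZ. Qed.

Lemma pactZr N x c (m : N) : pact N x (c *: m) = c *: pact N x m.
Proof. exact: linearZ. Qed.

Lemma even_hom_comp N (f g : N -> N) :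
  even_hom f -> even_hom g -> even_hom (f \o g).
Proof.
move=> [fl fp fa] [gl gp ga]; split=> [c u v|b m|x m] /=.
- by rewrite gl fl.
- by rewrite gp fp.
by rewrite ga fa.
Qed.

Lemma even_homB N (f g : N -> N) :
  even_hom f -> even_hom g -> even_hom (fun m => f m - g m).
Proof.
move=> [fl fp fa] [gl gp ga]; split=> [c u v|b m|x m] /=.
- by rewrite fl gl scalerBr opprD addrACA.
- by rewrite fp gp linearB.
by rewrite fa ga linearB.
Qed.

Lemma eq_even_hom N (f g : N -> N) : f =1 g -> even_hom f -> even_hom g.
Proof.
by move=> fg [fl fp fa]; split=> [c u v|b m|x m]; rewrite -!fg ?fl ?fp ?fa.
Qed.

Lemma even_hom_graded N (f : N -> N) : linear f ->
  (forall b m, f (ppr N b m) = ppr N b (f m)) ->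
  (forall p x m, glhom p (vsval x) -> f (pact N x m) = pact N x (f m)) ->
  even_hom f.
Proof.
move=> fl fp fa; split=> // x m.
pose g : {linear N -> N} := HB.pack f (GRing.isLinear.Build K N N *:%R f fl).
have pactD (x1 x2 : 'p[K]_n) m' :
  pact N (x1 + x2) m' = pact N x1 m' + pact N x2 m'.
  by have := @pact_linear K n N m' 1 x1 x2; rewrite !scale1r.
rewrite -(ppartD x) !pactD -[f]/(g : N -> N) linearD.
by rewrite -![g _]/(f _) !(fa _ _ _ (ppart_hom _ x)).
Qed.

Lemma pactZl N c (x : 'p[K]_n) m : pact N (c *: x) m = c *: pact N x m.
Proof.
have p0 : pact N 0 m = 0.
  by have := @pact_linear K n N m (-1) 0 0;
    rewrite scaler0 addr0 scaleN1r addNr.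
by have := @pact_linear K n N m c x 0; rewrite p0 !addr0.
Qed.

Lemma pactBl N (x y : 'p[K]_n) m : pact N (x - y) m = pact N x m - pact N y m.
Proof.
by have := @pact_linear K n N m (-1) y x; rewrite !scaleN1r ![- _ + _]addrC.
Qed.

Lemma pact_suml N (F : I -> 'p[K]_n) m :
  pact N (\sum_i F i) m = \sum_i pact N (F i) m.
Proof.
pose f x := pact N x m.
pose g : {linear 'p[K]_n -> N} :=
  HB.pack f (GRing.isLinear.Build K _ _ *:%R f (@pact_linear K n N m)).
by rewrite -[LHS]/(g _) linear_sum.
Qed.

Lemma pact_sumZl N (c : I -> K) (F : I -> 'p[K]_n) m :
  pact N (\sum_i c i *: F i) m = \sum_i c i *: pact N (F i) m.
Proof. by rewrite pact_suml; apply: eq_bigr => i _; rewrite pactZl. Qed.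

Lemma tens_idE N (f : N -> N) (w : tensV N) j : tens_id f w j = f (w j).
Proof. exact: sum_tens. Qed.

Lemma psgn_tensE N b (w : tensV N) i :
  psgn b w i = (-1) ^+ (b && ipar i) *: psgn b (w i).
Proof.
rewrite /psgn !ffunE !tens_pprE scalerDr scalerA -signr_addb.
by case: (ipar i); case: b; rewrite /= ?scale1r // addrC.
Qed.

Lemma even_hom_tens N (f : N -> N) : even_hom f -> even_hom (tens_id f :
  tensV N -> tensV N).
Proof.
move=> hf; have [fl fp fa] := hf; split=> [c u v|b m|x m]; apply/ffunP=> i.
- by rewrite !(ffunE, tens_idE) fl.
- by rewrite tens_idE !tens_pprE fp tens_idE.
rewrite tens_idE !tens_actE even_homD // even_hom_sum // fa tens_idE.
congr (_ + _); apply: eq_bigr => j _.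
by rewrite even_homZ // even_hom_psgn // tens_idE.
Qed.

(** C_{N,V} acts on N through elements of p(n) and through signs, both of which
    f commutes with. *)
Lemma casimir_natural N (f : N -> N) (w : tensV N) : even_hom f ->
  casimir (tens_id f w) = tens_id f (casimir w).
Proof.
move=> hf; have [fl fp fa] := hf; apply/ffunP=> i.
rewrite tens_idE !ffunE even_hom_sum //; apply: eq_bigr => j _.
by rewrite tens_idE fa (even_hom_psgn hf).
Qed.

(** The commutator of x with 2 C_{N,V} has three parts: the brackets of x with
    the entries of C, and the two products of the matrix of x with the matrix
    C, one on each side. Their sum vanishes by [pbr_casel]. *)
Lemma casimir_even_hom N : even_hom (@casimir K n N).
Proof.
apply: even_hom_graded => [c u v|b m|p x m hx]; apply/ffunP=> i; rewrite !ffunE.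
- rewrite scaler_sumr -big_split; apply: eq_bigr => j _ /=.
  by rewrite !ffunE !linearP.
- rewrite tens_pprE ffunE linear_sum; apply: eq_bigr => j _ /=.
  rewrite tens_pprE (ppr_act _ _ (casel_hom K i j)) ppr_psgn.
  by congr (pact _ _ (psgn _ (ppr _ _ _))); case: (ipar i); case: (ipar j);
    case: b.
rewrite (tens_act_hom _ _ hx) /sumact ffunE.
set s1 := LHS.
have -> : s1 = \sum_(j < n + n) (pact N (casel K i j) (psgn (ipar i (+) ipar j)
  (pact N x (m j))))
   + \sum_(j < n + n) \sum_(l < n + n) vsval x l j *: pact N (casel K i l)
     (psgn (ipar i (+) ipar j) (m j)).
  rewrite exchange_big -big_split; apply: eq_bigr => j _ /=.
  rewrite (tens_act_hom _ _ hx) /sumact (raddfD (psgn _)) (raddfD (pact N _))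
    /=.
  rewrite psgnM; congr (_ + _).
  rewrite psgn_sum pact_sumr; apply: eq_bigr => l _ /=.
  rewrite psgnZ pactZr (glhomE _ _ hx); case: eqP => [<-|_];
    last by rewrite !scale0r.
  congr (_ *: pact _ _ (psgn _ _)).
  by case: (ipar i); case: (ipar j); case: (ipar l).
have -> : psgn p (\sum_(j < n + n) vsval x i j *: casimir m j)
  = \sum_(j < n + n) \sum_(l < n + n) ((-1) ^+ (p && (ipar l (+) ipar j)) *
    vsval x i l)
       *: pact N (casel K l j) (psgn (ipar i (+) ipar j) (m j)).
  rewrite exchange_big psgn_sum; apply: eq_bigr => j _ /=.
  rewrite psgnZ ffunE psgn_sum scaler_sumr; apply: eq_bigr => l _ /=.
  rewrite (psgn_act _ _ (casel_hom K j l)) psgnM scalerA.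
  rewrite (glhomE _ _ hx); case: eqP => [<-|_];
    last by rewrite !(mulr0, mul0r, scale0r).
  rewrite mulrC andbC; congr (_ *: pact _ _ (psgn _ _)).
  by case: (ipar i); case: (ipar j); case: (ipar l).
rewrite pact_sumr -!big_split; apply: eq_bigr => j _ /=.
rewrite (psgn_act _ _ hx) andbC.
set u := psgn _ (m j).
have := pact_br u hx (casel_hom K i j).
rewrite -/(casel K i j) (pbr_casel i j hx) pactBl !pact_sumZl.
rewrite pactZr (andbC _ p).
set C1 := \sum_l _; set C2 := \sum_l _ => E.
by rewrite -[C1 in LHS](subrK C2) E addrA [_ + (_ - _)]addrC subrK.
Qed.

End EvenMaps.

(** * Flip, cup and cap on two copies of V *)

Section Local.

Variables (K : fieldType) (n : nat).
Implicit Types N : pmod K n.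

Local Notation I := 'I_(n + n).
Local Notation sg b := ((-1 : K) ^+ b).

(** In N (x) V (x) V the coefficient of e_a (x) e_b is w b a: the index of the
    last factor comes first. *)
Definition flip N (w : tensV (tensV N)) : tensV (tensV N) :=
  [ffun b => [ffun a => sg (ipar a && ipar b) *: w a b]].

(** The contraction with the odd form that pairs e_i with e_(bar i). *)
Definition cap N (w : tensV (tensV N)) : N := \sum_(j < n + n) w j (bar j).

(** The product of m by - sum_b (-1)^b e_(bar b) (x) e_b, a p(n)-invariant
    tensor, so that epsilon is [cup] after [cap]. *)
Definition cup N (m : N) : tensV (tensV N) :=
  [ffun b => [ffun a => (- (sg (ipar b) * (a == bar b)%:R)) *: m]].

Definition cupcap N (w : tensV (tensV N)) : tensV (tensV N) := cup (cap w).

Lemma sum_delta (V : lmodType K) (i : I) (F : I -> V) :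
  \sum_j (i == j)%:R *: F j = F i.
Proof.
rewrite (bigD1 i) //= big1 => [|j ji]; first by rewrite eqxx scale1r addr0.
by rewrite eq_sym (negPf ji) scale0r.
Qed.

(** The two terms of [casmxE] give the flip and epsilon: this is the equality 2
    C_{V,V} = s + epsilon, for coefficients F in any space. *)
Lemma sum_casmx (V : lmodType K) (F : I -> I -> V) (b a : I) :
  \sum_j \sum_l (casmx K b j a l * sg ((ipar b (+) ipar j) && ipar l)) *: F j l
  = sg (ipar a && ipar b) *: F a b
    - (sg (ipar b) * (a == bar b)%:R) *: \sum_j F j (bar j).
Proof.
transitivity (\sum_j \sum_l (
   (a == j)%:R *: ((b == l)%:R *: (sg (ipar j && ipar l) *: F j l))
   - (bar j == l)%:R *: ((sg (ipar b) * (a == bar b)%:R) *: F j l))).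
  apply: eq_bigr => j _; apply: eq_bigr => l _;
    rewrite casmxE !scalerA -scalerBl.
  congr (_ *: _); rewrite (eq_sym l b) (eq_sym l (bar j)).
  case: (b =P l) => [E1|_]; case: (bar j =P l) => [E2|_]; try subst l;
    try rewrite -E2;
    rewrite ?barK ?ipar_bar; case: (a == j); case: (a == bar b);
  by case: (ipar b); case: (ipar j) => /=; ring.
under eq_bigr do rewrite sumrB -scaler_sumr !sum_delta.
by rewrite sumrB sum_delta scaler_sumr.
Qed.

(** In C_{N (x) V, V} an entry of C acts either on N, or on the first V. The
    former is C_{N,V} conjugated by the flip, the latter C_{V,V}. *)
Lemma casimir_tensE N (w : tensV (tensV N)) :
  casimir w = flip (tens_id (@casimir K n N) (flip w)) + flip w + cupcap w.
Proof.
apply/ffunP=> b; apply/ffunP=> a; rewrite !ffunE sum_ffunE -addrA.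
under eq_bigr do rewrite tens_actE.
rewrite big_split /=; congr (_ + _).
  rewrite (@tens_idE K n (tensV N)) ffunE scaler_sumr; apply: eq_bigr => j _.
  rewrite psgn_tensE !ffunE psgnZ !pactZr scalerA -signr_addb; congr (_ *: _).
  by case: (ipar a); case: (ipar b); case: (ipar j).
rewrite scaleNr -(sum_casmx (fun j l => w j l)).
apply: eq_bigr => j _; apply: eq_bigr => l _.
rewrite psgn_tensE psgnZ psgnM scalerA.
rewrite (glhomE a l (casel_hom K b j)); case: eqP => [->|_];
  last by rewrite !(mul0r, scale0r).
by rewrite addbb psgn0.
Qed.

Lemma pact_tens2E N x (w : tensV (tensV N)) b a :
  pact (tensV (tensV N)) x w b a = pact N x (w b a)
  + \sum_j vsval x a j *: psgn (ipar a (+) ipar j) (w b j)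
  + \sum_j (sg ((ipar b (+) ipar j) && ipar a) * vsval x b j)
      *: psgn (ipar b (+) ipar j) (w j a).
Proof.
transitivity (tens_act x w b a); first by [].
rewrite tens_actE ffunE -(tens_actE x (w b)); congr (_ + _).
rewrite sum_ffunE; apply: eq_bigr => j _.
by rewrite ffunE psgn_tensE scalerA mulrC.
Qed.

Lemma flip_even_hom N : even_hom (@flip N).
Proof.
apply: even_hom_graded => [c u v|b m|p x m hx]; apply/ffunP=> i;
  apply/ffunP=> j; rewrite !ffunE.
- by rewrite scalerDr !scalerA mulrC.
- rewrite !tens_pprE !ffunE linearZ /= -!addbA; congr (_ *: ppr _ _ _).
  by rewrite (addbC (ipar i)).
transitivity (sg (ipar j && ipar i) *: (pact (tensV (tensV N)) x m) j i);
  first by [].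
rewrite !pact_tens2E !scalerDr addrAC !ffunE pactZr !scaler_sumr;
  congr (_ + _ + _);
  apply: eq_bigr => l _; rewrite !ffunE !psgnZ !scalerA;
 by congr (_ *: _); case: (ipar i); case: (ipar j); case: (ipar l) => /=; ring.
Qed.

Lemma flipK N : involutive (@flip N).
Proof.
move=> w; apply/ffunP=> b; apply/ffunP=> a; rewrite !ffunE scalerA.
by rewrite -signr_addb andbC addbb scale1r.
Qed.

(** By [casimir_tensE], epsilon is y_2 - s y_1 s - s. *)
Lemma cupcap_even_hom N : even_hom (@cupcap N).
Proof.
have hs := @flip_even_hom N.
have hy := @casimir_even_hom K n (tensV N).
have hy1 := even_hom_tens (@casimir_even_hom K n N).
apply: eq_even_hom (even_homB (even_homB hy (even_hom_comp hs (even_hom_comp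
  hy1 hs))) hs) => w /=.
have addr2K (V : zmodType) (u v t : V) : u + v + t - u - v = t.
  by rewrite -addrA -opprD addrC addKr.
by rewrite casimir_tensE addr2K.
Qed.

(** The form pairs the even with the odd basis vectors, and these contribute
    opposite signs. *)
Lemma cap_cup N (m : N) : cap (cup m) = 0.
Proof.
rewrite /cap.
under eq_bigr do rewrite !ffunE eqxx mulr1.
rewrite -scaler_suml sumrN big_split_ord /=.
under eq_bigr do rewrite ipar_lshift.
under [X in _ + X]eq_bigr do rewrite ipar_rshift.
by rewrite !big_const_ord !iter_addr_0 mulNrn subrr oppr0 scale0r.
Qed.

Lemma flip_cup N (m : N) : flip (cup m) = - cup m.
Proof.
apply/ffunP=> b; apply/ffunP=> a; rewrite !ffunE scalerA -scaleNr.
congr (_ *: _); rewrite -(eq_bar b a) (eq_sym (bar b)).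
case: (a =P bar b) => [->|_]; rewrite ?ipar_bar; case: (ipar b) => /=; ring.
Qed.

Lemma cap_flip N (w : tensV (tensV N)) : cap (flip w) = cap w.
Proof.
rewrite /cap (reindex_inj (inv_inj (@barK n))); apply: eq_bigr => j _.
by rewrite !ffunE barK ipar_bar; case: (ipar j); rewrite scale1r.
Qed.

(** The dual of p(n) acts in the same way on both factors of the invariant
    tensor of V (x) V, so C may be applied to either of them; the sign comes
    from [flip_cup]. *)
Lemma casimir_cup N (m : N) :
  tens_id (@casimir K n N) (cup m) = - flip (tens_id (@casimir K n N) (cup m)).
Proof.
have E a b : tens_id (@casimir K n N) (cup m) b a
    = (- sg (ipar b)) *: pact N (casel K a (bar b)) (psgn (ipar a (+) ~~ ipar
      b) m).
  rewrite (@tens_idE K n (tensV N)) ffunE.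
  under eq_bigr do rewrite !ffunE psgnZ pactZr eq_sym mulrC -mulrN -scalerA.
  by rewrite sum_delta ipar_bar; congr (_ *: _).
apply/ffunP=> b; apply/ffunP=> a; rewrite E !ffunE E.
have -> : casel K b (bar a)
  = (- sg (ipar a (+) ipar b (+) (ipar a && ipar b))) *: casel K a (bar b).
  by apply: val_inj; rewrite /= casmx_bar -scaleNr; congr (_ *: _).
rewrite pactZl !scalerA -scaleNr.
have -> : ipar b (+) ~~ ipar a = ipar a (+) ~~ ipar b by case: ipar; case: ipar.
congr (_ *: _); case: (ipar a); case: (ipar b) => /=; ring.
Qed.

Lemma cap_casimir_flip N (w : tensV (tensV N)) :
  cap (tens_id (@casimir K n N) (flip w)) = cap (tens_id (@casimir K n N) w).
Proof.
rewrite /cap.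
under eq_bigr do rewrite (@tens_idE K n (tensV N)) ffunE.
under [RHS]eq_bigr do rewrite (@tens_idE K n (tensV N)) ffunE.
rewrite exchange_big; apply: eq_bigr => j _; apply: eq_bigr => l _ /=.
rewrite !ffunE psgnZ pactZr.
have -> : casel K (bar l) j = (sg (ipar l && ipar j)) *: casel K (bar j) l.
  apply: val_inj; rewrite /= -[j in LHS]barK casmx_bar barK -scaleNr;
    congr (_ *: _); rewrite !ipar_bar.
  by case: (ipar j); case: (ipar l) => /=; ring.
rewrite pactZl scalerA -signr_addb andbC addbb scale1r !ipar_bar.
by congr (pact _ _ (psgn _ _)); case: (ipar j); case: (ipar l).
Qed.

End Local.

(** * Flip, cup and cap on three copies of V *)

Section ThreeSites.

Variables (K : fieldType) (n : nat).
Implicit Types N : pmod K n.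

Local Notation sg b := ((-1 : K) ^+ b).

Lemma cupZ N c (m : N) : cup (c *: m) = c *: cup m.
Proof. by apply/ffunP=> b; apply/ffunP=> a; rewrite !ffunE !scalerA mulrC. Qed.

Lemma cupcap_cupcap N (w : tensV (tensV N)) : cupcap (cupcap w) = 0.
Proof. by rewrite {1}/cupcap cap_cup -[0 in LHS](scale0r 0) cupZ scale0r. Qed.

(** Straightening a zigzag: a cup on the last two factors followed by a cap on
    the first two moves a vector along the strand, up to a sign that depends on
    its parity since the cup is odd. *)
Lemma cap_cupcap N (w : tensV (tensV (tensV N))) b :
  cap (cupcap w b) = (- sg (ipar b)) *: cap w b.
Proof.
rewrite /cap.
under eq_bigr do rewrite !ffunE eq_sym mulrC -mulrN -scalerA.
by rewrite (sum_delta _ (fun j => _ *: cap w (bar j))) barK.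
Qed.

Lemma cap_tens_cupcap N (w : tensV (tensV (tensV N))) a :
  cap (tens_id (@cupcap K n N) w) a = sg (ipar a) *: cap (w a).
Proof.
rewrite /cap sum_ffunE.
under eq_bigr do rewrite (@tens_idE K n (tensV (tensV N))) !ffunE barK mulrC
  -mulrN -scalerA.
by rewrite sum_delta ipar_bar; congr (_ *: _); case: (ipar a) => /=; ring.
Qed.

Lemma cap_tens_flip N (w : tensV (tensV (tensV N))) a :
  cap (tens_id (@flip K n N) w) a = sg (ipar a) *: cap (flip w a).
Proof.
rewrite /cap sum_ffunE scaler_sumr; apply: eq_bigr => k _.
rewrite (@tens_idE K n (tensV (tensV N))) !ffunE scalerA; congr (_ *: _).
by rewrite ipar_bar; case: (ipar a); case: (ipar k) => /=; ring.
Qed.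

(** One leg of the cup is moved across u b, at the cost of the sign (-1)^b that
    also turns up in [cap_tens_cupcap]. *)
Lemma tens_flip_cup N (u : tensV N) :
  tens_id (@flip K n N) (cup u)
  = flip ([ffun b => cup (sg (ipar b) *: u b)] : tensV (tensV (tensV N))).
Proof.
apply/ffunP=> c; rewrite (@tens_idE K n (tensV (tensV N))).
apply/ffunP=> b; apply/ffunP=> a; rewrite !ffunE !scalerA; congr (_ *: _).
case: (a =P bar c) => [->|_]; rewrite ?ipar_bar;
  case: (ipar b); case: (ipar c) => /=; ring.
Qed.

Variables (N : pmod K n) (w : tensV (tensV (tensV N))).

Local Notation s1 := (tens_id (@flip K n N)).
Local Notation s2 := (@flip K n (tensV N)).
Local Notation e1 := (tens_id (@cupcap K n N)).
Local Notation e2 := (@cupcap K n (tensV N)).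

Lemma flip_braid : s1 (s2 (s1 w)) = s2 (s1 (s2 w)).
Proof.
have E u c b a : s1 u c b a = sg (ipar a && ipar b) *: u c a b.
  by rewrite (@tens_idE K n (tensV (tensV N))) !ffunE.
have F u c b a : s2 u c b a = sg (ipar b && ipar c) *: u b c a.
  by rewrite !ffunE.
apply/ffunP=> c; apply/ffunP=> b; apply/ffunP=> a.
rewrite !(E, F) !scalerA; congr (_ *: _).
by case: (ipar a); case: (ipar b); case: (ipar c) => /=; ring.
Qed.

Lemma tens_cupcapE u c : e1 u c = cup (cap (u c)).
Proof. exact: (@tens_idE K n (tensV (tensV N))). Qed.

Lemma cupcap_ees : e1 (e2 (s1 w)) = - e1 (s2 w).
Proof.
apply/ffunP=> c; rewrite [RHS]ffunE !tens_cupcapE cap_cupcap cap_tens_flip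
  scalerA.
by rewrite mulNr -signr_addb addbb scaleN1r -scaleN1r cupZ scaleN1r.
Qed.

Lemma cupcap_see : s1 (e2 (e1 w)) = s2 (e1 w).
Proof.
rewrite -[e2 _]/(cup _) tens_flip_cup; congr flip; apply/ffunP=> b.
by rewrite ffunE tens_cupcapE cap_tens_cupcap scalerA -signr_addb addbb scale1r.
Qed.

Lemma cupcap_see' : s2 (e1 (e2 w)) = - s1 (e2 w).
Proof.
rewrite [in RHS]/cupcap tens_flip_cup -scaleN1r.
rewrite -(even_homZ (@flip_even_hom K n (tensV N))); congr flip;
  apply/ffunP=> b.
by rewrite tens_cupcapE cap_cupcap !ffunE -!cupZ scalerA mulN1r.
Qed.

Lemma cupcap_ees' : e2 (e1 (s2 w)) = e2 (s1 w).
Proof.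
by congr cup; apply/ffunP=> a; rewrite cap_tens_cupcap cap_tens_flip.
Qed.

Lemma cupcap_eee : e2 (e1 (e2 w)) = - e2 w.
Proof.
rewrite -scaleN1r -cupZ; congr cup; apply/ffunP=> a.
by rewrite cap_tens_cupcap cap_cupcap scalerA mulrN -signr_addb addbb ffunE.
Qed.

Lemma cupcap_eee' : e1 (e2 (e1 w)) = - e1 w.
Proof.
apply/ffunP=> c; rewrite [RHS]ffunE !tens_cupcapE cap_cupcap cap_tens_cupcap
  scalerA.
by rewrite mulNr -signr_addb addbb -scaleN1r cupZ.
Qed.

End ThreeSites.

(** * Relations between y_1, y_2, s and epsilon *)

Section TwoSites.

Variables (K : fieldType) (n : nat) (N : pmod K n) (w : tensV (tensV N)).

Local Notation s := (@flip K n N).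
Local Notation e := (@cupcap K n N).
Local Notation y1 := (tens_id (@casimir K n N)).
Local Notation y2 := (@casimir K n (tensV N)).

Lemma cupcap_flip : e (s w) = e w.
Proof. by rewrite /cupcap cap_flip. Qed.

Lemma flip_cupcap : s (e w) = - e w.
Proof. exact: flip_cup. Qed.

Lemma flip_casimir : y1 (s w) - s (y2 w) = e w - w.
Proof.
have hs := @flip_even_hom K n N.
rewrite casimir_tensE !(even_homD hs) !flipK flip_cupcap.
by rewrite !opprD opprK addrA addrA subrr sub0r addrC.
Qed.

Lemma casimir_flip : s (y1 w) - y2 (s w) = - e w - w.
Proof.
by rewrite casimir_tensE !flipK cupcap_flip -addrA opprD addrA subrr add0r
  opprD addrC.
Qed.

Lemma casimir_cupcap : y1 (e w) - y2 (e w) = e w.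
Proof.
have hs := @flip_even_hom K n N;
  have hy := even_hom_tens (@casimir_even_hom K n N).
have E : s (y1 (e w))
  = - y1 (e w) by rewrite [in RHS]/cupcap [in RHS]casimir_cup opprK.
have -> : y2 (e w) = y1 (e w) - e w.
  rewrite casimir_tensE cupcap_cupcap addr0 flip_cupcap; congr (_ - _).
  by rewrite -scaleN1r (even_homZ hy) (even_homZ hs) E scaleN1r opprK.
by rewrite opprB addrC subrK.
Qed.

Lemma cupcap_casimir : e (y1 w) - e (y2 w) = - e w.
Proof.
have he := @cupcap_even_hom K n N.
have esw u : e (s u) = e u by rewrite /cupcap cap_flip.
rewrite casimir_tensE !(even_homD he) cupcap_cupcap addr0 !esw {2}/cupcap
  cap_casimir_flip -/(cupcap _).
by rewrite opprD addrA subrr sub0r.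
Qed.

End TwoSites.

(** * The operators swapVV and epsVV tensored with a module *)

Section Pairs.

Variables (K : fieldType) (n : nat) (B : dual_bases K n).
Hypothesis two_neq0 : 2 != 0 :> K.
Implicit Types N : pmod K n.

Local Notation I := 'I_(n + n).
Local Notation e j := (delta_mx j 0 : 'cV[K]_(n + n)).
Local Notation VV := (tensV (natV K n)).

Lemma sum_delta2 (V : lmodType K) (i j : I) (F : I -> I -> V) :
  \sum_(c < n + n) \sum_(d < n + n) ((c == i) && (d == j))%:R *: F c d = F i j.
Proof.
rewrite -(sum_delta i (F^~ j)); apply: eq_bigr => c _; rewrite eq_sym.
rewrite -(sum_delta j (F c)) scaler_sumr; apply: eq_bigr => d _.
by rewrite -mulnb natrM -scalerA (eq_sym d).
Qed.

Lemma tens2E N (m : N) (u : VV) b a :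
  tens2 m u b a = (u b : 'cV[K]_(n + n)) a 0 *: m.
Proof.
rewrite /tens2 sum_ffunE sum_ffunE (bigD1 a) //= [X in _ + X]big1 => [|a' aa].
  rewrite addr0 sum_ffunE sum_ffunE (bigD1 b) //= [X in _ + X]big1 => [|b' bb].
    by rewrite !ffunE !mxE !eqxx !scale1r addr0.
  by rewrite !ffunE !mxE (eq_sym b) (negPf bb) scale0r scaler0.
rewrite sum_ffunE sum_ffunE big1 // => b' _.
by rewrite !ffunE !mxE (eq_sym a) (negPf aa) scale0r !scaler0.
Qed.

Lemma id_tensE (f : VV -> VV) N (w : tensV (tensV N)) b a :
  id_tens f w b a = \sum_(c < n + n) \sum_(d < n + n)
    (f (tens (e c : natV K n) (e d)) b : 'cV[K]_(n + n)) a 0 *: w d c.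
Proof.
rewrite /id_tens sum_ffunE sum_ffunE; apply: eq_bigr => c _.
rewrite sum_ffunE sum_ffunE; apply: eq_bigr => d _.
by rewrite tens2E.
Qed.

(** In the coordinates of [id_tensE], f and h act on different indices. *)
Lemma id_tens_natural (f : VV -> VV) N (h : N -> N) (w : tensV (tensV N)) :
  even_hom h -> id_tens f (tens_id (tens_id h) w)
    = tens_id (tens_id h) (id_tens f w).
Proof.
move=> hh; apply/ffunP=> b; apply/ffunP=> a.
rewrite (@tens_idE K n (tensV N)) tens_idE !id_tensE even_hom_sum //.
apply: eq_bigr => c _; rewrite even_hom_sum //; apply: eq_bigr => d _.
by rewrite even_homZ // (@tens_idE K n (tensV N)) tens_idE.
Qed.

Lemma tens_deltaE (c d i j : I) :
  (tens (e c : natV K n) (e d) i : 'cV[K]_(n + n)) j 0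
    = ((c == j) && (d == i))%:R.
Proof.
rewrite ffunE !mxE !eqxx !andbT (eq_sym i) (eq_sym j).
by case: (c == j); case: (d == i); rewrite ?mulr1 ?mulr0.
Qed.

Lemma swapVVE (u : VV) (b a : I) : (swapVV u b : 'cV[K]_(n + n)) a 0
  = (-1) ^+ (ipar a && ipar b) * (u a : 'cV[K]_(n + n)) b 0.
Proof.
rewrite /swapVV sum_ffunE (bigD1 b) //= [X in _ + X]big1 => [|c cb].
  rewrite addr0 sum_ffunE summxE (bigD1 a) //= big1 ?addr0 => [|d da].
    by rewrite !ffunE !mxE !eqxx !mulr1 andbC.
  by rewrite !ffunE !mxE (eq_sym a) (negPf da) /= !mulr0.
rewrite sum_ffunE big1 // => d _.
by rewrite !ffunE !mxE (eq_sym b) (negPf cb) /= scale0r scaler0.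
Qed.

Lemma psgn_natE (v : natV K n) b i : (psgn b v : 'cV[K]_(n + n)) i 0
  = (-1) ^+ (b && ipar i) * (v : 'cV[K]_(n + n)) i 0.
Proof.
by rewrite /psgn !mxE; case: (ipar i); case: b; rewrite /=; ring.
Qed.

Lemma epsVVE (u : VV) (b a : I) : (epsVV B u b : 'cV[K]_(n + n)) a 0
  = - ((-1) ^+ ipar b * (a == bar b)%:R) * \sum_j (u j : 'cV[K]_(n + n)) (bar
    j) 0.
Proof.
rewrite /epsVV (opC_casimir B two_neq0) ffunE [(- swapVV u) b]ffunE mxE [X in _
  + X]mxE swapVVE ffunE.
have -> : (\sum_(j < n + n) pact (natV K n) (casel K b j) (psgn (ipar b (+)
  ipar j) (u j)) : 'cV[K]_(n + n)) a 0
  = \sum_j \sum_l (casmx K b j a l * (-1) ^+ ((ipar b (+) ipar j) && ipar l))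
    *: ((u j : 'cV[K]_(n + n)) l 0 : K^o).
  rewrite summxE; apply: eq_bigr => j _; rewrite mxE; apply: eq_bigr => l _.
  by rewrite psgn_natE mulrA.
by rewrite sum_casmx addrAC subrr add0r mulNr.
Qed.

Lemma id_tens_swap N (w : tensV (tensV N)) : id_tens (@swapVV K n) w = flip w.
Proof.
apply/ffunP=> b; apply/ffunP=> a; rewrite id_tensE !ffunE.
under eq_bigr do under eq_bigr do rewrite swapVVE tens_deltaE mulrC -scalerA.
exact: (sum_delta2 b a (fun c d => _ *: w d c)).
Qed.

Lemma id_tens_eps N (w : tensV (tensV N)) : id_tens (epsVV B) w = cupcap w.
Proof.
apply/ffunP=> b; apply/ffunP=> a; rewrite id_tensE !ffunE.
under eq_bigr do under eq_bigr do rewrite epsVVE -scalerA scaler_suml.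
under eq_bigr do rewrite -scaler_sumr.
rewrite -scaler_sumr; congr (_ *: _); rewrite /cap.
under eq_bigr do rewrite exchange_big.
rewrite exchange_big; apply: eq_bigr => j _ /=.
under eq_bigr do under eq_bigr do rewrite tens_deltaE.
exact: (sum_delta2 (bar j) j (fun c d => w d c)).
Qed.

End Pairs.

(** * The operators on M (x) V^d *)

(* Types such as tensVn M d.+2 and tensV (tensV (tensVn M d)) must be
   compared by unfolding the tower;
     expanding the module structures on both sides takes time
   exponential in the number of factors. *)
Strategy -1000 [tensVn].
Strategy 1000 [tensV].

Section Tower.

Variables (K : fieldType) (n : nat) (B : dual_bases K n) (M : pmod K n).
Hypothesis two_neq0 : 2 != 0 :> K.

Local Notation I := 'I_(n + n).
Local Notation T d := (tensVn M d).

(** The coefficient of w at the vector e_j of the last factor V. Giving it a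
    name of its own keeps the types tensVn M d in the lemmas below folded. *)
Definition slice d (w : T d.+1) (j : I) : T d := (w : tensV (T d)) j.

Lemma slice_inj d (w w' : T d.+1) : slice w =1 slice w' -> w = w'.
Proof. by move=> h; apply/ffunP. Qed.

Lemma sliceD d (w w' : T d.+1) j : slice (w + w') j = slice w j + slice w' j.
Proof. exact: ffunE. Qed.

Lemma sliceN d (w : T d.+1) j : slice (- w) j = - slice w j.
Proof. exact: ffunE. Qed.

Lemma slice0 d j : slice (0 : T d.+1) j = 0.
Proof. exact: ffunE. Qed.

Lemma op2_top f d (w : T d.+2) : op2 f d w = id_tens f (N := T d) w.
Proof. by rewrite /= eqxx. Qed.

Lemma op2_low f d a (w : T d.+1) :
  (a.+1 < d)%N -> op2 f a w = tens_id (op2 f (d := d) a) w.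
Proof. by move=> ad; rewrite /= ltn_eqF. Qed.

Lemma slice_op2 f d a (w : T d.+1) j : (a.+1 < d)%N ->
  slice (op2 f a w) j = op2 f a (slice w j).
Proof. by move=> ad; rewrite op2_low //; apply: tens_idE. Qed.

Lemma op_y_top d (w : T d.+1) : op_y B d w = casimir (w : tensV (T d)).
Proof. by rewrite /= eqxx; apply: opC_casimir. Qed.

Lemma op_y_low d j (w : T d.+1) :
  (j < d)%N -> op_y B j w = tens_id (op_y B (d := d) j) w.
Proof. by move=> jd; rewrite /= ltn_eqF. Qed.

Lemma slice_op_y d j (w : T d.+1) i : (j < d)%N ->
  slice (op_y B j w) i = op_y B j (slice w i).
Proof. by move=> jd; rewrite op_y_low //; apply: tens_idE. Qed.

Lemma op_s_top d (w : T d.+2) : op_s d w = flip (w : tensV (tensV (T d))).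
Proof. by rewrite /op_s op2_top id_tens_swap. Qed.

Lemma op_e_top d (w : T d.+2) : op_e B d w = cupcap (w : tensV (tensV (T d))).
Proof. by rewrite /op_e op2_top (id_tens_eps B two_neq0). Qed.

Lemma tens_id_eq (N : pmod K n) (f g : N -> N) (w : tensV N) :
  f =1 g -> tens_id f w = tens_id g w.
Proof. by move=> fg; apply/ffunP=> j; rewrite !tens_idE. Qed.

Lemma op_s_top1 d (w : T d.+3) : op_s d w = tens_id (@flip K n (T d)) w.
Proof.
by rewrite /op_s op2_low //; apply: tens_id_eq => u; apply: op_s_top.
Qed.

Lemma op_e_top1 d (w : T d.+3) : op_e B d w = tens_id (@cupcap K n (T d)) w.
Proof.
by rewrite /op_e op2_low //; apply: tens_id_eq => u; apply: op_e_top.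
Qed.

Lemma op_y_top1 d (w : T d.+2) : op_y B d w = tens_id (@casimir K n (T d)) w.
Proof. by rewrite op_y_low //; apply: tens_id_eq => u; apply: op_y_top. Qed.

Lemma op2_even_hom f : (forall N, even_hom (id_tens f (N := N))) ->
  forall d a, (a.+1 < d)%N -> even_hom (op2 f (d := d) a : T d -> T d).
Proof.
move=> hf; elim=> // d IH a; rewrite ltnS leq_eqVlt => /predU1P[ad|ad].
  by rewrite -ad; apply: eq_even_hom (hf (T a)) => w; rewrite op2_top.
by apply: eq_even_hom (even_hom_tens (IH a ad)) => w; rewrite op2_low.
Qed.

Lemma op_s_even_hom d a : (a.+1 < d)%N -> even_hom (op_s a : T d -> T d).
Proof.
apply: op2_even_hom => N; apply: eq_even_hom (@flip_even_hom K n N) => w.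
by rewrite id_tens_swap.
Qed.

Lemma op_e_even_hom d a : (a.+1 < d)%N -> even_hom (op_e B a : T d -> T d).
Proof.
apply: op2_even_hom => N; apply: eq_even_hom (@cupcap_even_hom K n N) => w.
by rewrite (id_tens_eps B two_neq0).
Qed.

Lemma op_y_even_hom d j : (j < d)%N -> even_hom (op_y B j : T d -> T d).
Proof.
elim: d j => // d IH j; rewrite ltnS leq_eqVlt => /predU1P[jd|jd].
  by rewrite jd; apply: eq_even_hom (@casimir_even_hom K n (T d)) => w;
    rewrite op_y_top.
by apply: eq_even_hom (even_hom_tens (IH j jd)) => w; rewrite op_y_low.
Qed.

(** When b is the last pair, g acts on M (x) V^b only, so [id_tens_natural]
    applies. *)
Lemma op2_far f g d a b (w : T d) : (a.+1 < b)%N -> (b.+1 < d)%N ->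
  even_hom (op2 g a : T b -> T b) -> op2 f b (op2 g a w) = op2 g a (op2 f b w).
Proof.
move=> ab bd hg; elim: d w bd => // d IH w;
  rewrite ltnS leq_eqVlt => /predU1P[bd|bd].
  move: w; rewrite -bd => w; rewrite !op2_top.
  have E u : op2 (M := M) g (d := b.+2) a u
    = tens_id (tens_id (op2 g (d := b) a)) u.
    rewrite op2_low ?(ltn_trans ab) //; apply: tens_id_eq => v.
    by rewrite op2_low.
  by rewrite !E id_tens_natural.
have ad := ltn_trans ab (ltn_trans (ltnSn b) bd).
by apply: slice_inj => j; rewrite !slice_op2 // IH.
Qed.

(** If i < a, then y_i acts to the left of f; if i > a + 1, then f is an even
    equivariant map on the left of y_i, and [casimir_natural] applies. *)
Lemma op_y_op2 f d a i (w : T d) : (a.+1 < d)%N -> (i < d)%N ->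
  i != a -> i != a.+1 -> (forall d', (a.+1 < d')%N ->
    even_hom (op2 f a : T d' -> T d')) ->
  op_y B i (op2 f a w) = op2 f a (op_y B i w).
Proof.
move=> ad lid ia ia1 hf; elim: d w ad lid => // d IH w.
rewrite !ltnS leq_eqVlt => /predU1P[ad|ad].
  move: w; rewrite -ad => w; rewrite leq_eqVlt (negPf ia1) orFb ltnS.
  rewrite leq_eqVlt (negPf ia) orFb => {}ia.
  have E u : op_y B (M := M) (d := a.+2) i u
    = tens_id (tens_id (op_y B (d := a) i)) u.
    rewrite op_y_low ?ltnS ?(ltnW ia) //; apply: tens_id_eq => v.
    by rewrite op_y_low.
  by rewrite !op2_top !E id_tens_natural //; apply: op_y_even_hom.
rewrite leq_eqVlt => /predU1P[lid|lid].
  move: w; rewrite lid => w; rewrite !op_y_top !op2_low //.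
  by rewrite casimir_natural //; apply: hf.
by apply: slice_inj => j; rewrite !(slice_op2, slice_op_y) // IH.
Qed.

Lemma op_y_comm d i j (w : T d) : (i < j)%N -> (j < d)%N ->
  op_y B j (op_y B i w) = op_y B i (op_y B j w).
Proof.
move=> ij; elim: d w => // d IH w; rewrite ltnS leq_eqVlt => /predU1P[jd|jd].
  move: w; rewrite -jd => w; rewrite !op_y_top !op_y_low //.
  by rewrite casimir_natural //; apply: op_y_even_hom.
have lid := ltn_trans ij jd.
by apply: slice_inj => k; rewrite !slice_op_y // IH.
Qed.

End Tower.

(** * The relations on M (x) V^d *)

Section Relations.

Variables (K : fieldType) (n : nat) (B : dual_bases K n) (M : pmod K n).
Hypothesis two_neq0 : 2 != 0 :> K.

Local Notation T d := (tensVn M d).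

Lemma slice_s d a (w : T d.+1) j :
  (a.+1 < d)%N -> slice (op_s a w) j = op_s a (slice w j).
Proof. exact: slice_op2. Qed.

Lemma slice_e d a (w : T d.+1) j :
  (a.+1 < d)%N -> slice (op_e B a w) j = op_e B a (slice w j).
Proof. exact: slice_op2. Qed.

Definition sliceE := (slice_s, slice_e, slice_op_y, sliceD, sliceN, slice0).

(** For F and G the two sides of a relation, with k the number of factors up to
    the last one on which they act: on k factors the relation concerns explicit
    operators on the last factors, and larger d are reached by slicing. *)
Lemma tower_eq k (F G : forall d, T d -> T d) :
    (forall w : T k, F k w = G k w) ->
    (forall d (w : T d.+1) j, (k <= d)%N ->
      slice (F d.+1 w) j = F d (slice w j)) ->
    (forall d (w : T d.+1) j, (k <= d)%N ->
      slice (G d.+1 w) j = G d (slice w j)) ->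
  forall d (w : T d), (k <= d)%N -> F d w = G d w.
Proof.
move=> FG0 hF hG; elim=> [|d IH] w; first by rewrite leqn0 => /eqP k0;
  move: FG0; rewrite k0.
rewrite leq_eqVlt => /predU1P[kd|kd]; first by move: FG0; rewrite kd.
by apply: slice_inj => j; rewrite hF // hG // IH.
Qed.

Lemma op_ss d a (w : T d) : (a.+1 < d)%N ->
  op_s a (op_s a w) = w.
Proof.
move: d w; apply: (@tower_eq a.+2
  (fun d w => op_s a (op_s a w))
  (fun d w => w)) => [w|d w j ad|d w j ad].
  by rewrite !op_s_top flipK.
all: by have ad' := ltnW ad; rewrite ?sliceE.
Qed.

Lemma op_ee d a (w : T d) : (a.+1 < d)%N ->
  op_e B a (op_e B a w) = 0.
Proof.
move: d w; apply: (@tower_eq a.+2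
  (fun d w => op_e B a (op_e B a w))
  (fun d w => 0)) => [w|d w j ad|d w j ad].
  by rewrite !op_e_top // cupcap_cupcap.
all: by have ad' := ltnW ad; rewrite ?sliceE.
Qed.

Lemma op_se d a (w : T d) : (a.+1 < d)%N ->
  op_s a (op_e B a w) = - op_e B a w.
Proof.
move: d w; apply: (@tower_eq a.+2
  (fun d w => op_s a (op_e B a w))
  (fun d w => - op_e B a w)) => [w|d w j ad|d w j ad].
  by rewrite op_s_top !op_e_top // flip_cupcap.
all: by have ad' := ltnW ad; rewrite ?sliceE.
Qed.

Lemma op_es d a (w : T d) : (a.+1 < d)%N ->
  op_e B a (op_s a w) = op_e B a w.
Proof.
move: d w; apply: (@tower_eq a.+2
  (fun d w => op_e B a (op_s a w))
  (fun d w => op_e B a w)) => [w|d w j ad|d w j ad].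
  by rewrite op_s_top !op_e_top // cupcap_flip.
all: by have ad' := ltnW ad; rewrite ?sliceE.
Qed.

Lemma op_y_op_s d a (w : T d) : (a.+1 < d)%N ->
  op_y B a (op_s a w) - op_s a (op_y B a.+1 w) = op_e B a w - w.
Proof.
move: d w; apply: (@tower_eq a.+2
  (fun d w => op_y B a (op_s a w) - op_s a (op_y B a.+1 w))
  (fun d w => op_e B a w - w)) => [w|d w j ad|d w j ad].
  by rewrite !op_s_top op_e_top // op_y_top // op_y_top1 // flip_casimir.
all: by have ad' := ltnW ad; rewrite ?sliceE.
Qed.

Lemma op_s_op_y d a (w : T d) : (a.+1 < d)%N ->
  op_s a (op_y B a w) - op_y B a.+1 (op_s a w) = - op_e B a w - w.
Proof.
move: d w; apply: (@tower_eq a.+2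
  (fun d w => op_s a (op_y B a w) - op_y B a.+1 (op_s a w))
  (fun d w => - op_e B a w - w)) => [w|d w j ad|d w j ad].
  by rewrite !op_s_top op_e_top // op_y_top // op_y_top1 // casimir_flip.
all: by have ad' := ltnW ad; rewrite ?sliceE.
Qed.

Lemma op_y_op_e d a (w : T d) : (a.+1 < d)%N ->
  op_y B a (op_e B a w) - op_y B a.+1 (op_e B a w) = op_e B a w.
Proof.
move: d w; apply: (@tower_eq a.+2
  (fun d w => op_y B a (op_e B a w) - op_y B a.+1 (op_e B a w))
  (fun d w => op_e B a w)) => [w|d w j ad|d w j ad].
  by rewrite !op_e_top // op_y_top // op_y_top1 // casimir_cupcap.
all: by have ad' := ltnW ad; rewrite ?sliceE.
Qed.

Lemma op_e_op_y d a (w : T d) : (a.+1 < d)%N ->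
  op_e B a (op_y B a w) - op_e B a (op_y B a.+1 w) = - op_e B a w.
Proof.
move: d w; apply: (@tower_eq a.+2
  (fun d w => op_e B a (op_y B a w) - op_e B a (op_y B a.+1 w))
  (fun d w => - op_e B a w)) => [w|d w j ad|d w j ad].
  by rewrite !op_e_top // op_y_top // op_y_top1 // cupcap_casimir.
all: by have ad' := ltnW ad; rewrite ?sliceE.
Qed.

Lemma op_sss d c (w : T d) : (c.+2 < d)%N ->
  op_s c (op_s c.+1 (op_s c w)) = op_s c.+1 (op_s c (op_s c.+1 w)).
Proof.
move: d w; apply: (@tower_eq c.+3
  (fun d w => op_s c (op_s c.+1 (op_s c w)))
  (fun d w => op_s c.+1 (op_s c (op_s c.+1 w)))) => [w|d w j ad|d w j ad].
  by rewrite !op_s_top !op_s_top1 flip_braid.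
all: by have ad' := ltnW ad; rewrite ?sliceE.
Qed.

Lemma op_ees d c (w : T d) : (c.+2 < d)%N ->
  op_e B c (op_e B c.+1 (op_s c w)) = - op_e B c (op_s c.+1 w).
Proof.
move: d w; apply: (@tower_eq c.+3
  (fun d w => op_e B c (op_e B c.+1 (op_s c w)))
  (fun d w => - op_e B c (op_s c.+1 w))) => [w|d w j ad|d w j ad].
  by rewrite !op_e_top1 // op_e_top // op_s_top op_s_top1 cupcap_ees.
all: by have ad' := ltnW ad; rewrite ?sliceE.
Qed.

Lemma op_see d c (w : T d) : (c.+2 < d)%N ->
  op_s c (op_e B c.+1 (op_e B c w)) = op_s c.+1 (op_e B c w).
Proof.
move: d w; apply: (@tower_eq c.+3
  (fun d w => op_s c (op_e B c.+1 (op_e B c w)))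
  (fun d w => op_s c.+1 (op_e B c w))) => [w|d w j ad|d w j ad].
  by rewrite !op_e_top1 // op_e_top // op_s_top op_s_top1 cupcap_see.
all: by have ad' := ltnW ad; rewrite ?sliceE.
Qed.

Lemma op_see' d c (w : T d) : (c.+2 < d)%N ->
  op_s c.+1 (op_e B c (op_e B c.+1 w)) = - op_s c (op_e B c.+1 w).
Proof.
move: d w; apply: (@tower_eq c.+3
  (fun d w => op_s c.+1 (op_e B c (op_e B c.+1 w)))
  (fun d w => - op_s c (op_e B c.+1 w))) => [w|d w j ad|d w j ad].
  by rewrite !op_e_top // op_e_top1 // op_s_top op_s_top1 cupcap_see'.
all: by have ad' := ltnW ad; rewrite ?sliceE.
Qed.

Lemma op_ees' d c (w : T d) : (c.+2 < d)%N ->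
  op_e B c.+1 (op_e B c (op_s c.+1 w)) = op_e B c.+1 (op_s c w).
Proof.
move: d w; apply: (@tower_eq c.+3
  (fun d w => op_e B c.+1 (op_e B c (op_s c.+1 w)))
  (fun d w => op_e B c.+1 (op_s c w))) => [w|d w j ad|d w j ad].
  by rewrite !op_e_top // op_e_top1 // op_s_top op_s_top1 cupcap_ees'.
all: by have ad' := ltnW ad; rewrite ?sliceE.
Qed.

Lemma op_eee d c (w : T d) : (c.+2 < d)%N ->
  op_e B c.+1 (op_e B c (op_e B c.+1 w)) = - op_e B c.+1 w.
Proof.
move: d w; apply: (@tower_eq c.+3
  (fun d w => op_e B c.+1 (op_e B c (op_e B c.+1 w)))
  (fun d w => - op_e B c.+1 w)) => [w|d w j ad|d w j ad].
  by rewrite !op_e_top // op_e_top1 // cupcap_eee.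
all: by have ad' := ltnW ad; rewrite ?sliceE.
Qed.

Lemma op_eee' d c (w : T d) : (c.+2 < d)%N ->
  op_e B c (op_e B c.+1 (op_e B c w)) = - op_e B c w.
Proof.
move: d w; apply: (@tower_eq c.+3
  (fun d w => op_e B c (op_e B c.+1 (op_e B c w)))
  (fun d w => - op_e B c w)) => [w|d w j ad|d w j ad].
  by rewrite !op_e_top1 // op_e_top // cupcap_eee'.
all: by have ad' := ltnW ad; rewrite ?sliceE.
Qed.

End Relations.

(** * The universal property of a presented algebra *)

Section Universal.

Variables (K : comNzRingType) (G : Type) (rls : expr K G -> expr K G -> Prop).
Variables (A : pzRingType) (iota : {rmorphism K -> A}) (rho : G -> A).
Hypothesis iotaC : forall c x, iota c * x = x * iota c.

Fixpoint eval (t : expr K G) : A :=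
  match t with
  | Gen g => rho g
  | Cst c => iota c
  | Add s t => eval s + eval t
  | Mul s t => eval s * eval t
  end.

Hypothesis eval_rls : forall s t, rls s t -> eval s = eval t.

Lemma eval_cong s t : cong rls s t -> eval s = eval t.
Proof.
elim=> {s t} [s t /eval_rls||s t _ ->|s t u _ ->
  _ ->|s s' t t' _ + _|s s' t t' _ + _
  |||||||||a b|a b|c t] //=.
- by move=> -> ->.
- by move=> -> ->.
- by move=> s t u; rewrite addrA.
- by move=> s t; rewrite addrC.
- by move=> t; rewrite rmorph0 add0r.
- by move=> s t u; rewrite mulrA.
- by move=> t; rewrite rmorph0 mul0r.
- by move=> t; rewrite rmorph1 mul1r.
- by move=> s t u; rewrite mulrDl.
- by move=> s t u; rewrite mulrDr.
- by rewrite rmorphD.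
- by rewrite rmorphM.
Qed.

Definition palg_eval (x : palg rls) : A := eval (repr x).

Lemma palg_evalE t : palg_eval (pcls rls t) = eval t.
Proof. exact/eval_cong/cong_repr. Qed.

Fact palg_eval_zmod : zmod_morphism palg_eval.
Proof.
have evalD x y : palg_eval (x + y) = palg_eval x + palg_eval y.
  elim/palg_ind: x => s; elim/palg_ind: y => t.
  by rewrite -[pcls _ s + _]/(padd _ _) pcls_add !palg_evalE.
by move=> x y; rewrite -[in RHS](subrK y x) [in RHS]evalD addrK.
Qed.

Fact palg_eval_monoid : monoid_morphism palg_eval.
Proof.
split=> [|x y]; first by rewrite -[1]/(pcls rls (Cst 1)) palg_evalE /= rmorph1.
elim/palg_ind: x => s; elim/palg_ind: y => t.
by rewrite -[pcls _ s * _]/(pmul _ _) pcls_mul !palg_evalE.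
Qed.

Lemma palg_lift : exists Psi : {rmorphism palg rls -> A},
  (forall g, Psi (pgen rls g) = rho g) /\
  (forall c x, Psi (c *: x) = iota c * Psi x).
Proof.
pose Psi : {rmorphism palg rls -> A} := HB.pack palg_eval
  (GRing.isZmodMorphism.Build _ _ palg_eval palg_eval_zmod)
  (GRing.isMonoidMorphism.Build _ _ palg_eval palg_eval_monoid).
exists Psi; split=> [g|c x]; first exact: palg_evalE.
by rewrite -[c *: x]/(pcls rls (Cst c) * x) rmorphM /= palg_evalE.
Qed.

End Universal.

(** * Scalars in the opposite of the algebra of equivariant maps *)

Section OppositeEnd.

Variables (K : fieldType) (n : nat) (N : pmod K n).

Lemma endg_oppP (f g : (endg N)^c) : (forall v, (f : endg N) v = (g :
  endg N) v) -> f = g.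
Proof. by move=> fg; apply: val_inj; apply/funext. Qed.

Lemma endg_linear (f : endg N) : linear f.
Proof. by have /asboolP[] := endg_prop f. Qed.

Definition endg_cst (c : K) : (endg N)^c := c *: (1 : endg N).

Lemma endg_cstv c v : (endg_cst c : endg N) v = c *: v.
Proof. by []. Qed.

Fact endg_cst_zmod : zmod_morphism endg_cst.
Proof. by move=> a b; rewrite /endg_cst scalerBl. Qed.

Fact endg_cst_monoid : monoid_morphism endg_cst.
Proof.
split=> [|a b]; first by rewrite /endg_cst scale1r.
by apply: endg_oppP => v; rewrite endg_oppM !endg_cstv scalerA mulrC.
Qed.

HB.instance Definition _ := GRing.isZmodMorphism.Build K (endg N)^c endg_cst
  endg_cst_zmod.
HB.instance Definition _ := GRing.isMonoidMorphism.Build K (endg N)^c endg_cst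
  endg_cst_monoid.

Lemma endg_cstE c (f : (endg N)^c) : endg_cst c * f = c *: f.
Proof.
apply: endg_oppP => v; rewrite endg_oppM endg_oppZ endg_cstv.
have lf := endg_linear f.
have f0 : (f : endg N) 0 = 0.
  by have := lf (-1) 0 0; rewrite scaler0 addr0 scaleN1r addNr.
by have := lf c v 0; rewrite f0 !addr0.
Qed.

Lemma endg_cstC c (f : (endg N)^c) : endg_cst c * f = f * endg_cst c.
Proof. by rewrite endg_cstE; apply: endg_oppP => v. Qed.

Lemma even_hom_endg (f : N -> N) : even_hom f -> f \in @endg_pred K n N.
Proof. by case=> lf _ af; apply/asboolP. Qed.

End OppositeEnd.

(** * The vanishing of epsilon y^k epsilon *)

Section Vanishing.

Variables (A : pzRingType) (s e y z : A).
Hypotheses (es : e * s = - e) (se : s * e = e).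
Hypothesis sy : s * y = z * s + e - 1.
Hypothesis ez : e * z = e * (y - 1).
Hypothesis yz : y * z = z * y.

Let ez_exp k : e * z ^+ k = e * (y - 1) ^+ k.
Proof.
have c : GRing.comm z (y - 1).
  by rewrite /GRing.comm mulrBr mulrBl mulr1 mul1r yz.
elim: k => [|k IH]; first by rewrite !expr0.
by rewrite exprS mulrA ez -mulrA (commrX _ (commr_sym c)) mulrA IH -mulrA
  -exprSr.
Qed.

Let e_lower k i j : (forall l, (l < k)%N -> e * y ^+ l * e = 0) ->
  (i + j < k)%N -> e * (y - 1) ^+ i * y ^+ j * e = 0.
Proof.
move=> H; elim: i j => [|i IH] j ijk; first by rewrite expr0 mulr1 H.
have -> : e * (y - 1) ^+ i.+1 * y ^+ j * e
  = e * (y - 1) ^+ i * y ^+ j.+1 * e - e * (y - 1) ^+ i * y ^+ j * e.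
  by rewrite exprSr exprS !(mulrA, mulrBr, mulrBl, mulr1, mul1r).
by rewrite !IH ?subr0 // ?addnS // ltnW.
Qed.

Let e_top k i j : (forall l, (l < k)%N -> e * y ^+ l * e = 0) ->
  (i + j = k)%N -> e * (y - 1) ^+ i * y ^+ j * e = e * y ^+ k * e.
Proof.
move=> H; elim: i j => [|i IH] j ijk; first by rewrite expr0 mulr1 -ijk.
have -> : e * (y - 1) ^+ i.+1 * y ^+ j * e
  = e * (y - 1) ^+ i * y ^+ j.+1 * e - e * (y - 1) ^+ i * y ^+ j * e.
  by rewrite exprSr exprS !(mulrA, mulrBr, mulrBl, mulr1, mul1r).
by rewrite IH ?addnS // (e_lower H) ?subr0 // -ijk.
Qed.

(** Strong induction on k. As s e = e and e s = - e, sliding s from the left to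
    the right of y^k in e s y^k e gives - e y^k e = e z^k e: each step only
    creates words e z^i y^m e and e z^i e y^m e with i + m < k, which vanish by
    induction. On the other hand e turns z into y - 1, so that e z^k e is e y^k
    e up to shorter words. *)
Lemma sandwich_eq0 : (forall x : A, x + x = 0 -> x = 0) ->
  forall k, e * y ^+ k * e = 0.
Proof.
move=> reg2 k; elim/ltn_ind: k => k H.
(* Here s has crossed i of the k letters y, which have become z. *)
have P i m : (i + m = k)%N -> e * z ^+ i * s * y ^+ m * e = e * z ^+ k * e.
  elim: m i => [|m IH] i imk.
    by rewrite expr0 mulr1 -mulrA se -imk addn0.
  rewrite exprS -!mulrA (mulrA s) sy !(mulrBl, mulrDl, mul1r, mulrDr, mulrBr).
  have -> : e * (z ^+ i * (z * s * (y ^+ m * e)))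
    = e * z ^+ i.+1 * s * y ^+ m * e.
    by rewrite exprSr !mulrA.
  rewrite IH ?addSn -?addnS // ; rewrite !(mulrA e) !mulrA !ez_exp.
  have := e_lower (i := i) (j := 0) H; rewrite expr0 mulr1 => ->; last first.
    by rewrite -imk ltn_add2l.
  by rewrite !mul0r addr0 mulrN !mulrA;
    rewrite (e_lower H) ?subr0 // -imk addnS ltnSn.
apply: reg2; have := P 0%N k (erefl _).
rewrite expr0 mulr1 es ez_exp mulNr mulNr.
have := e_top (i := k) (j := 0) H; rewrite expr0 mulr1 addn0 => -> // E.
by rewrite -{1}E addNr.
Qed.

End Vanishing.

(** * The action of the affine periplectic Brauer algebra *)

Section Action.

Variables (K : fieldType) (n d : nat) (B : dual_bases K n) (M : pmod K n).
Hypothesis two_neq0 : 2 != 0 :> K.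

Local Notation T := (tensVn M d).
Local Notation E := (endg T)^c.

Lemma ltS_ord_pred (a : 'I_d.-1) : (a.+1 < d)%N.
Proof. by rewrite -ltn_predRL. Qed.

Definition rep_s (a : 'I_d.-1) : E :=
  Endg (even_hom_endg (op_s_even_hom M (ltS_ord_pred a))).
Definition rep_e (a : 'I_d.-1) : E :=
  Endg (even_hom_endg (op_e_even_hom B M two_neq0 (ltS_ord_pred a))).
Definition rep_y (j : 'I_d) : E :=
  Endg (even_hom_endg (op_y_even_hom B M two_neq0 (ltn_ord j))).

Definition rep_gen (g : apb_gen d) : E :=
  match g with GS a => rep_s a | GE a => rep_e a | GY j => rep_y j end.

Lemma rep_sE a v : (rep_s a : endg T) v = op_s a v.
Proof. by []. Qed.
Lemma rep_eE a v : (rep_e a : endg T) v = op_e B a v.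
Proof. by []. Qed.
Lemma rep_yE j v : (rep_y j : endg T) v = op_y B j v.
Proof. by []. Qed.
Lemma repD (f g : E) v : (f + g : endg T) v = (f : endg T) v + (g : endg T) v.
Proof. by []. Qed.
Lemma repN (f : E) v : (- f : endg T) v = - (f : endg T) v.
Proof. by []. Qed.
Lemma rep0 v : (0 : endg T) v = 0.
Proof. by []. Qed.
Lemma rep1 v : (1 : endg T) v = v.
Proof. by []. Qed.

Definition repE := (endg_oppM, rep_sE, rep_eE, rep_yE, repD, repN, rep0, rep1).

Lemma rep_sy (a : 'I_d.-1) (j j' : 'I_d) : j = a :> nat -> j' = a.+1 :> nat ->
  rep_s a * rep_y j - rep_y j' * rep_s a = rep_e a - 1.
Proof.
by move=> ja ja'; apply: endg_oppP => v;
  rewrite !repE ja ja' op_y_op_s // ltS_ord_pred.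
Qed.

Lemma rep_ey (a : 'I_d.-1) (j j' : 'I_d) : j = a :> nat -> j' = a.+1 :> nat ->
  rep_e a * (rep_y j - rep_y j') = rep_e a.
Proof.
by move=> ja ja'; apply: endg_oppP => v;
  rewrite !repE ja ja' op_y_op_e // ltS_ord_pred.
Qed.

Lemma rep_ee a : rep_e a * rep_e a = 0.
Proof. by apply: endg_oppP => v; rewrite !repE op_ee // ltS_ord_pred. Qed.

Lemma rep_es a : rep_e a * rep_s a = - rep_e a.
Proof. by apply: endg_oppP => v; rewrite !repE op_se // ltS_ord_pred. Qed.

Lemma rep_se a : rep_s a * rep_e a = rep_e a.
Proof. by apply: endg_oppP => v; rewrite !repE op_es // ltS_ord_pred. Qed.

Lemma rep_yy i j : rep_y i * rep_y j = rep_y j * rep_y i.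
Proof.
apply: endg_oppP => v; rewrite !repE.
case: (ltngtP i j) => [ij|ji|/val_inj-> //].
  exact: op_y_comm.
exact/esym/op_y_comm.
Qed.

Lemma rep_eye (a : 'I_d.-1) (j : 'I_d) k : j = a :> nat ->
  rep_e a * rep_y j ^+ k * rep_e a = 0.
Proof.
move=> ja; pose j' := Ordinal (ltS_ord_pred a).
have ja' : j' = a.+1 :> nat by [].
have sy : rep_s a * rep_y j = rep_y j' * rep_s a + rep_e a - 1.
  by rewrite -addrA -(rep_sy ja ja') addrC subrK.
have ez : rep_e a * rep_y j' = rep_e a * (rep_y j - 1).
  by rewrite mulrBr mulr1 -[X in _ - X](rep_ey ja ja') mulrBr opprB addrC subrK.
apply: (sandwich_eq0 (rep_es a) (rep_se a) sy ez (rep_yy j j')).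
move=> f ff; apply: endg_oppP => v; rewrite rep0.
have : (f + f : endg T) v = 0 by rewrite ff.
rewrite repD -mulr2n -scaler_nat => /eqP; rewrite scaler_eq0 (negPf two_neq0).
by move/eqP.
Qed.

Lemma eval_exp (t : expr K (apb_gen d)) k :
  eval (@endg_cst K n T) rep_gen (t ^+ k)%expr
    = eval (@endg_cst K n T) rep_gen t ^+ k.
Proof. by elim: k => [|k IH] /=; rewrite ?rmorph1 // IH exprS. Qed.

Lemma op2_farC f g (w : T) (a b : 'I_d.-1) : far a b ->
  (forall d' c, (c.+1 < d')%N -> even_hom (op2 f c : tensVn M d' ->
    tensVn M d')) ->
  (forall d' c, (c.+1 < d')%N -> even_hom (op2 g c : tensVn M d' ->
    tensVn M d')) ->
  op2 g b (op2 f a w) = op2 f a (op2 g b w).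
Proof.
move=> fab hf hg; have la := ltS_ord_pred a; have lb := ltS_ord_pred b.
case/orP: fab => [ab|ba]; first by rewrite op2_far //; apply: hf.
by rewrite (op2_far _ _ ba) //; apply: hg.
Qed.

Lemma rep_relations s t : apb_rel s t ->
  eval (@endg_cst K n T) rep_gen s = eval (@endg_cst K n T) rep_gen t.
Proof.
have hs := @op_s_even_hom K n M; have he := @op_e_even_hom K n B M two_neq0.
have cstN1 : endg_cst T (-1) = -1 by rewrite rmorphN1.
have cst1 : endg_cst T 1 = 1 by rewrite rmorph1.
have cst0 : endg_cst T 0 = 0 by rewrite rmorph0.
have lt2 (c c' : 'I_d.-1) : c' = c.+1 :> nat -> (c.+2 < d)%N.
  by move=> <-; apply: ltS_ord_pred.
case=> {s t} [a|a b ab|c c' cc|a i ia ia1|a|a j k a0 j0 _|a b ab|a b ab|a i ia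
  ia1|i j
  |a|a|c c' cc|c c' cc|c c' cc|c c' cc|c c' cc|c c' cc
  |a j j' ja ja'|a j j' ja ja'|a j j' ja ja'|a j j' ja ja'] /=;
  rewrite ?(cstN1, cst1, cst0) ?mulN1r.
- by apply: endg_oppP => v; rewrite !repE op_ss // ltS_ord_pred.
- by apply: endg_oppP => v; rewrite !repE; apply: op2_farC.
- by apply: endg_oppP => v; rewrite !repE cc op_sss // (lt2 _ _ cc).
- apply: endg_oppP => v; rewrite !repE;
  apply: (op_y_op2 B two_neq0) => // [|d' ad].
    exact: ltS_ord_pred.
  exact: hs.
- exact: rep_ee.
- by rewrite eval_exp; apply: rep_eye; rewrite a0 j0.
- by apply: endg_oppP => v; rewrite !repE; apply: op2_farC.
- by apply: endg_oppP => v; rewrite !repE; apply: op2_farC.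
- apply: endg_oppP => v; rewrite !repE;
  apply: (op_y_op2 B two_neq0) => // [|d' ad].
    exact: ltS_ord_pred.
  exact: he.
- exact: rep_yy.
- exact: rep_es.
- by rewrite rep_se.
- by apply: endg_oppP => v; rewrite !repE cc op_ees // (lt2 _ _ cc).
- by apply: endg_oppP => v; rewrite !repE cc op_see // (lt2 _ _ cc).
- by apply: endg_oppP => v; rewrite !repE cc op_see' // (lt2 _ _ cc).
- by apply: endg_oppP => v; rewrite !repE cc op_ees' // (lt2 _ _ cc).
- by apply: endg_oppP => v; rewrite !repE cc op_eee // (lt2 _ _ cc).
- by apply: endg_oppP => v; rewrite !repE cc op_eee' // (lt2 _ _ cc).
- exact: rep_sy.
- apply: endg_oppP => v; rewrite !repE ja ja'.
  by rewrite op_s_op_y // ltS_ord_pred.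
- exact: rep_ey.
rewrite mulrBl; apply: endg_oppP => v; rewrite !repE ja ja'.
by rewrite op_e_op_y // ltS_ord_pred.
Qed.

End Action.

Theorem theorem3p6 (R : realType) (n d : nat) (n_gt0 : (0 < n)%N)
    (d_gt0 : (0 < d)%N) (B : dual_bases R[i] n) (M : pmod R[i] n) :
  exists Psi : {rmorphism apb R[i] d -> (endg (tensVn M d))^c},
    [/\ forall (c : R[i]) (p : apb R[i] d), Psi (c *: p) = c *: Psi p,
        forall (a : 'I_d.-1) (v : tensVn M d),
          (Psi (apb_s R[i] a) : endg (tensVn M d)) v = op_s a v,
        forall (a : 'I_d.-1) (v : tensVn M d),
          (Psi (apb_e R[i] a) : endg (tensVn M d)) v = op_e B a v
      & forall (j : 'I_d) (v : tensVn M d),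
          (Psi (apb_y R[i] j) : endg (tensVn M d)) v = op_y B j v].
Proof.
have two_neq0 : 2 != 0 :> R[i] by rewrite Num.Theory.pnatr_eq0.
have [Psi [PsiG PsiZ]] := palg_lift (@endg_cstC _ _ _)
  (@rep_relations _ _ d B M two_neq0).
have PsiE g v : (Psi (pgen _ g) : endg _) v = (rep_gen B M two_neq0 g :
  endg _) v.
  by rewrite PsiG.
exists Psi; split=> [c p|a v|a v|j v]; first by rewrite PsiZ endg_cstE.
- exact: (PsiE (GS a)).
- exact: (PsiE (GE a)).
- exact: (PsiE (GY j)).
Qed.
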